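(* Let $\tau : \Omega^X \times X \to Y$ be an (everywhere defined, measurable) random transformation such that for every $\omega\in\Omega^X$ the map $\tau(\omega,\cdot):X\to Y$ maps $\sigma$ to $\mu$, i.e. the image measure of $\sigma$ under $\tau(\omega,\cdot)$ is $\mu$. Assume that $\tau$ satisfies, for all $k\ge 1$, the cyclic condition $$ D_{t_1}\tau(\omega,t_2)\, D_{t_2}\tau(\omega,t_3)\cdots D_{t_{k-1}}\tau(\omega,t_k)\,D_{t_k}\tau(\omega,t_1)=0,\qquad \forall\,\omega\in\Omega^X,\ \forall\, t_1,\dots,t_k\in X, $$ which is understood as follows: for all $k\ge1$, $\omega\in\Omega^X$ and $t_1,\dots,t_k\in X$ there is an index $i\in\{1,\dots,k\}$ such that $\tau(\omega\cup\{t_i\},t_{i+1})=\tau(\omega,t_{i+1})$, where $t_{k+1}:=t_1$ (in particular, for $k=1$, $\tau(\omega\cup\{t\},t)=\tau(\omega,t)$ for all $\omega\in\Omega^X$, $t\in X$). Then $\tau_*:\Omega^X\to\Omega^Y$ maps $\pi_\sigma$ to $\pi_\mu$, i.e. the image measure $\tau_*\pi_\sigma$ is equal to $\pi_\mu$, the Poisson measure with intensity $\mu(dy)$ on $Y$.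
   Context: $X$ and $Y$ are $\sigma$-compact metric spaces with their Borel $\sigma$-algebras, equipped with $\sigma$-finite diffuse measures $\sigma$ on $X$ and $\mu$ on $Y$. The configuration space $\Omega^X$ is the space of at most countable, locally finite subsets $\omega=(x_i)_{i=1}^N$ of $X$ ($x_i\neq x_j$ for $i\ne j$, $N\in\mathbb{N}\cup\{\infty\}$); each $\omega$ is identified with the Radon point measure $\omega=\sum_{i=1}^{\omega(X)}\epsilon_{x_i}$, $\epsilon_x$ the Dirac measure at $x$. $\pi_\sigma$ is the Poisson measure with intensity $\sigma$: the unique probability measure on $\Omega^X$ under which, for all disjoint compact subsets $A_1,\dots,A_n$ of $X$, $n\ge1$, the variables $\omega(A_1),\dots,\omega(A_n)$ are independent $\mathbb{N}$-valued Poisson random variables with respective intensities $\sigma(A_1),\dots,\sigma(A_n)$ (so $\sigma$ is finite on compact sets). $\Omega^Y$ and $\pi_\mu$ are defined in the same way from $(Y,\mu)$. For a random transformation $\tau:\Omega^X\times X\to Y$, the map $\tau_*:\Omega^X\to\Omega^Y$ sends $\omega=\sum_{i=1}^{\omega(X)}\epsilon_{x_i}$ to $\tau_*(\omega)=\sum_{i=1}^{\omega(X)}\epsilon_{\tau(\omega,x_i)}$, the image measure of $\omega$ under $\tau(\omega,\cdot)$. *)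

(* Defs.v *)
From HB Require Import structures.
From mathcomp Require Import all_boot all_order all_algebra.
From mathcomp Require Import all_classical all_reals all_analysis measurable_realfun.

Set Implicit Arguments.
Unset Strict Implicit.
Unset Printing Implicit Defensive.

Import Order.TTheory GRing.Theory Num.Theory.

Local Open Scope classical_set_scope.
Local Open Scope ring_scope.

(* A measurableType is always pointed, so a metric space with its Borel
   sigma-algebra has to be nonempty. *)
#[short(type="pmetricType")]
HB.structure Definition PointedMetric (R : numDomainType) :=
  {M of Pointed M & Metric R M}.

Notation borel X := (g_sigma_algebraType (@open X)).

Definition sigma_compact (X : topologicalType) : Prop :=
  exists2 K : nat -> set X, (forall n, compact (K n)) & \bigcup_n K n = setT.

Definition locally_finite (X : topologicalType) (A : set X) : Prop :=
  forall x : X, exists2 U : set X, nbhs x U & finite_set (A `&` U).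

Record config (X : topologicalType) := Config {
  points :> set X ;
  points_countable : countable points ;
  points_locally_finite : locally_finite points }.

HB.instance Definition _ (X : topologicalType) := gen_eqMixin (config X).
HB.instance Definition _ (X : topologicalType) := gen_choiceMixin (config X).

Lemma locally_finite_set0 (X : topologicalType) : locally_finite (@set0 X).
Proof. by move=> x; exists setT; [exact: filterT | rewrite set0I]. Qed.

Definition config0 (X : topologicalType) : config X :=
  Config (@countable0 X) (@locally_finite_set0 X).

HB.instance Definition _ (X : topologicalType) :=
  isPointed.Build (config X) (config0 X).

Lemma countable_add_point (X : topologicalType) (w : config X) (t : X) :
  countable (w `|` [set t]).
Proof.
rewrite -bigcup2E; apply: bigcup_countable => //.
by move=> [|[|i]] _ //=; exact: points_countable.
Qed.

Lemma locally_finite_add_point (X : topologicalType) (w : config X) (t : X) :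
  locally_finite (w `|` [set t]).
Proof.
move=> x; have [U Ux finU] := points_locally_finite w x.
exists U => //; rewrite setIUl finite_setU; split => //.
exact/finite_setIl/finite_set1.
Qed.

Definition add_point (X : topologicalType) (w : config X) (t : X) : config X :=
  Config (@countable_add_point X w t) (@locally_finite_add_point X w t).

Section configuration_space.
Context {R : realType}.
Local Open Scope ereal_scope.

Definition config_measure (X : pmetricType R) (w : config X)
    (A : set (borel X)) : \bar R :=
  \esum_(x in points w) \d_(x : borel X) A.

Definition config_events (X : pmetricType R) : set (set (config X)) :=
  \bigcup_(A in [set A : set X | compact A])
    preimage_set_system setT (fun w => config_measure w A)
      (measurable : set (set (\bar R))).

End configuration_space.

Notation Omega X := (g_sigma_algebraType (@config_events _ X)).

Section laws.
Context {R : realType}.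
Local Open Scope ereal_scope.

Definition mutually_independent d (T : measurableType d) (P : probability T R)
    (n : nat) (N : 'I_n -> T -> \bar R) : Prop :=
  forall (J : {set 'I_n}) (B : 'I_n -> set (\bar R)),
    (forall i, measurable (B i)) ->
    P (\bigcap_(i in [set` J]) (N i @^-1` B i)) =
    \prod_(i in J) P (N i @^-1` B i).

(* [poisson_pmf] of the library is constantly 1 at rate 0, whereas here
   rate 0 must give the Dirac mass at 0. *)
Definition poisson_law d (T : measurableType d) (P : probability T R)
    (N : T -> \bar R) (lam : \bar R) : Prop :=
  lam \is a fin_num /\
  forall k : nat, P (N @^-1` [set k%:R%:E]) =
    (expR (- fine lam) * fine lam ^+ k / k`!%:R)%:E.

Definition is_poisson_measure (X : pmetricType R)
    (sigma : set (borel X) -> \bar R) (P : probability (Omega X) R) : Prop :=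
  forall (n : nat) (A : 'I_n -> set X),
    (forall i, compact (A i)) -> trivIset setT A ->
    mutually_independent P (fun i w => config_measure w (A i)) /\
    forall i, poisson_law P (fun w => config_measure w (A i)) (sigma (A i)).

Definition diffuse (X : pmetricType R) (sigma : set (borel X) -> \bar R)
    : Prop :=
  forall x : X, sigma [set x] = 0.

Definition maps_measure d d' (S : measurableType d) (T : measurableType d')
    (f : S -> T) (m : set S -> \bar R) (m' : set T -> \bar R) : Prop :=
  measurable_fun setT f /\
  forall B : set T, measurable B -> pushforward m f B = m' B.

End laws.

Section transformation.
Context {R : realType} (X Y : pmetricType R).
Local Open Scope ereal_scope.

Definition is_image_config (f : X -> Y) (w : config X) (eta : config Y)
    : Prop :=
  forall B : set (borel Y), measurable B ->
    config_measure eta B = \esum_(x in points w) \d_(f x : borel Y) B.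

(* The image measure of w under [tau w] may have multiple points or fail to be
   locally finite; for such w the value is the empty configuration. *)
Definition tau_star (tau : config X -> X -> Y) (w : config X) : config Y :=
  xget (config0 Y) (is_image_config (tau w) w).

(* [ordS] is the cyclic successor on 'I_k. *)
Definition cyclic_condition (tau : config X -> X -> Y) : Prop :=
  forall (k : nat) (w : config X) (t : 'I_k -> X), (0 < k)%N ->
    exists i : 'I_k,
      tau (add_point w (t i)) (t (ordS i)) = tau w (t (ordS i)).

End transformation.

(* Main.v *)
Require Import Defs.
From HB Require Import structures.
From mathcomp Require Import all_boot all_order all_algebra.
From mathcomp Require Import finmap.
From mathcomp Require Import all_classical all_reals all_analysis measurable_realfun.
From mathcomp Require Import zify ring lra.

(** A law on configurations is determined by its avoidance probabilities on
    compact sets ([measurable_void_events]). So everything rests on the number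
    N(w) of points x of w with tau(w, x) in a Borel set B such that
    c = mu(B) is finite, and on the identity P(N = 0) = exp(-c).

    Write g(w, x) for the indicator of tau(w, x) in B. By Mecke's formula
    ([mecke]), applied k times, the factorial moment E[N (N-1) ... (N-k+1)] is
    the expectation of
      T_k(w) = int prod_i g(w + x_1 + ... + x_k, x_i) sigma(dx_1)...sigma(dx_k).
    Were the points not to influence each other through tau, T_k(w) would be
    int prod_i g(w, x_i) = c^k. The cyclic condition says that the influence of
    single points has no cycle, for each base configuration. It follows that
    some x_i is not influenced by all the other points together
    ([uninfluenced_point]): otherwise, by induction applied to the points other
    than x_i over the base w + x_i, each x_i influences over w one of the
    points, and following these influences closes a cycle.

    Consequently prod_i (F_i - f_i) = 0, where F_i is the factor
    g(w + x_1 + ... + x_k, x_i) and f_i = g(w, x_i). Expand this product and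
    integrate. In a term with at least one factor f_i, the variables that carry
    a factor F_i are integrated first: relative to the base enlarged by the
    remaining variables they form a T_j with j < k, so that by induction the
    integral is c^k up to its sign. As the signs add up to 0, the term with
    all factors F_i, which is T_k(w), equals c^k as well
    ([iter_int_mixed_prod_exp]). Thus N has the factorial moments of a Poisson
    variable of mean c, and Bonferroni's inequalities give P(N = 0) = exp(-c)
    ([void_probability]).

    The image of w must also be a configuration for almost every w. The
    intensity mu is finite near each point, because under pi_mu each
    configuration leaves a punctured neighbourhood of the point empty
    ([poisson_intensity_locally_finite]); since E[N] = c, the image is then
    locally finite. It has no multiple point because
    P(N >= 2) <= E[N] - P(N >= 1) = c - 1 + exp(-c) <= c^2
    ([image_count_multiple]), which becomes negligible when summed over a
    partition of a compact set into pieces of small measure. Both properties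
    amount to countably many conditions ([proper_image]), which makes
    [tau_star] measurable on all configurations. *)

Set Implicit Arguments.
Unset Strict Implicit.
Unset Printing Implicit Defensive.

Import Order.TTheory GRing.Theory Num.Theory.
Import numFieldNormedType.Exports.

Local Open Scope classical_set_scope.
Local Open Scope ring_scope.

(** * Configurations as point measures *)

(** A finite subcover turns a local property that is stable under unions into
    a property of one neighbourhood of the compact set. It is used for
    finiteness of a point count and for finiteness of a measure. *)
Lemma compact_union_cover (T : ptopologicalType) (K : set T)
    (P : set T -> Prop) :
  compact K -> P set0 -> (forall A B, P A -> P B -> P (A `|` B)) ->
  (forall x, K x -> exists2 U, open_nbhs x U & P U) ->
  exists V, [/\ open V, K `<=` V & P V].
Proof.
rewrite compact_cover => cK P0 PU PK.
have /choice[f fP] : forall x, exists U, K x -> open_nbhs x U /\ P U.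
  move=> x; have [/PK[U xU PU']|nKx] := pselect (K x); first by exists U.
  by exists set0.
have [x Kx|x Kx|D DK KD] := cK _ K f.
- by have [[]] := fP x Kx.
- by exists x => //; have [[]] := fP x Kx.
exists (\big[setU/set0]_(i <- D) f i); split.
- rewrite big_seq; elim/big_ind : _; [exact: open0|exact: openU|].
  by move=> i /DK; rewrite inE => /fP[] [].
- by move=> x /KD[i /= Di fiy]; rewrite -bigcup_fset; exists i.
- by rewrite big_seq; elim/big_ind : _ => // i /DK; rewrite inE => /fP[].
Qed.

Section point_measure.
Context {R : realType} (X : pmetricType R).
Implicit Types (w : config X) (A B : set (borel X)).
Local Open Scope ereal_scope.

Lemma open_measurable_borel (A : set X) :
  open A -> measurable (A : set (borel X)).
Proof. by move=> oA; exact: sub_gen_smallest. Qed.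

Lemma closed_measurable_borel (A : set X) :
  closed A -> measurable (A : set (borel X)).
Proof.
move=> cA; rewrite -[A]setCK; apply: measurableC.
by apply: open_measurable_borel; exact: closed_openC.
Qed.

Lemma compact_measurable_borel (A : set X) :
  compact A -> measurable (A : set (borel X)).
Proof.
move=> cA; apply: closed_measurable_borel.
by apply: compact_closed => //; exact: (@metric_hausdorff R X).
Qed.

Lemma set1_measurable_borel (x : X) : measurable ([set x] : set (borel X)).
Proof. by apply: compact_measurable_borel; exact: compact_set1. Qed.

Let cm0 w : config_measure w set0 = 0.
Proof. by rewrite /config_measure esum1// => x _; rewrite dirac0. Qed.

Let cm_ge0 w A : 0 <= config_measure w A.
Proof. exact: esum_ge0. Qed.

Let cm_sigma_additive w : semi_sigma_additive (config_measure w).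
Proof.
move=> F mF tF mUF; apply: cvg_toP.
  by apply: is_cvg_ereal_nneg_natsum_cond => n _ _; exact: cm_ge0.
rewrite nneseries_esumT; last by move=> n; exact: cm_ge0.
rewrite /config_measure.
rewrite (@esum_esum R _ _ setT (fun=> points w)
  (fun n x => \d_(x : borel X) (F n)))//.
transitivity (\esum_(x in points w) \esum_(n in [set: nat])
    (\d_(x : borel X) (F n) : \bar R)).
  rewrite (@esum_esum R _ _ (points w) (fun=> setT)
    (fun x n => \d_(x : borel X) (F n)))//.
  rewrite (reindex_esum
    [set z | [set: nat] z.1 /\ points w z.2]
    [set z | points w z.1 /\ [set: nat] z.2] (fun z => (z.2, z.1)))//.
  split => //.
  - by move=> [n x] [_ /= ?].
  - by move=> [a b] [c e] _ _ /= [-> ->].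
  - by move=> [x n] [/= wx _]; exists (n, x).
apply: eq_esum => x wx; rewrite -nneseries_esumT//.
exact/esym/measure_semi_bigcup.
Qed.

HB.instance Definition _ w := isMeasure.Build _ _ _
  (config_measure w) (cm0 w) (@cm_ge0 w) (@cm_sigma_additive w).

Lemma config_measureE w A :
  config_measure w A = \esum_(x in points w `&` A) 1.
Proof.
rewrite /config_measure [RHS]esum_mkcondr; apply: eq_esum => x _.
by rewrite diracE; case: ifPn.
Qed.

Lemma config_measure_finite w A : finite_set (points w `&` A) ->
  config_measure w A < +oo.
Proof.
move=> fA; rewrite config_measureE esum_fset// fsbig_finite//=.
by rewrite lte_sum_pinfty// => *; rewrite ltry.
Qed.

Let esum1_ge1 (S : set X) x : S x -> 1 <= \esum_(y in S) (1 : \bar R).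
Proof.
move=> Sx; apply: esum_ge; exists [set x]; last by rewrite fsbig_set1.
by split; [exact: finite_set1|move=> _ ->].
Qed.

Lemma config_measure_ge1 w A x : points w x -> A x -> 1 <= config_measure w A.
Proof. by move=> wx Ax; rewrite config_measureE (esum1_ge1 (x := x)). Qed.

Lemma config_measure_ge2 w A x y : points w x -> A x -> points w y -> A y ->
  x <> y -> 2%:E <= config_measure w A.
Proof.
move=> wx Ax wy Ay xy; rewrite config_measureE (esumID [set x])//.
rewrite (_ : 2%:E = 1 + 1)//; apply: leeD.
  by apply: (esum1_ge1 (x := x)).
by apply: (esum1_ge1 (x := y)); split => // yx; exact: xy.
Qed.

Lemma config_measure_infinite w A :
  config_measure w A < +oo -> finite_set (points w `&` A).
Proof.
apply: contraPP => /(@infinite_card_dirac _ (borel X) R) infA.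
rewrite config_measureE (_ : (\esum_(x in _) 1)%E = +oo)//.
by rewrite -infA; apply: eq_esum => x wAx; rewrite diracE mem_set.
Qed.

Lemma config_measure_nat w A : config_measure w A < +oo ->
  exists n : nat, config_measure w A = n%:R%:E.
Proof.
move=> /config_measure_infinite fA; rewrite config_measureE.
exists #|` fset_set (points w `&` A)|.
exact: (@finite_card_sum _ (borel X) R).
Qed.

Lemma config_measure_eq0 w A :
  (config_measure w A = 0) <-> (points w `&` A = set0).
Proof.
split=> [wA0|wA0]; last by rewrite config_measureE wA0 esum_set0.
apply/seteqP; split => // x [wx Ax].
by have := config_measure_ge1 wx Ax; rewrite wA0 lee_fin ler10.
Qed.

Lemma config_measure_le1 w A :
  (forall x y, points w x -> A x -> points w y -> A y -> x = y) ->
  config_measure w A <= 1.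
Proof.
move=> wA; have [wA0|/set0P[x [wx Ax]]] := eqVneq (points w `&` A) set0.
  by rewrite (config_measure_eq0 w A).2.
rewrite config_measureE (_ : _ `&` _ = [set x]) ?esum_set1//.
by apply/seteqP; split => [y [wy Ay]|_ ->//] /=; exact: wA.
Qed.

Lemma config_compact_finite w (A : set X) :
  compact A -> finite_set (points w `&` A).
Proof.
move=> cA; have [|B C fB fC|x Ax|V [_ AV]] :=
  compact_union_cover (P := fun U => finite_set (points w `&` U)) cA.
- by rewrite setI0.
- by rewrite setIUr finite_setU.
- have [U Ux fU] := points_locally_finite w x; exists U^°.
    by split; [exact: open_interior|exact: Ux].
  by apply: sub_finite_set fU; apply: setIS; exact: interior_subset.
- by apply: sub_finite_set; exact: setIS.
Qed.

Lemma config_measure_compact w (A : set X) :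
  compact A -> config_measure w A < +oo.
Proof. by move=> /(config_compact_finite w); exact: config_measure_finite. Qed.

(** Proofs of countability and of local finiteness are irrelevant, so
    configurations can be compared as sets. *)
Lemma config_ext w w' : points w = points w' -> w = w'.
Proof.
case: w w' => [p cp lp] [q cq lq] /= pq; move: cp lp cq lq; rewrite pq => *.
by congr Config; exact: Prop_irrelevance.
Qed.

Lemma config_measure_add_point w x A : ~ points w x ->
  config_measure (add_point w x) A = config_measure w A + \d_(x : borel X) A.
Proof.
move=> wx; rewrite /config_measure (esumID [set x])// addeC; congr (_ + _).
  by congr esum; apply/seteqP; split=> [y [[//|]]//|y wy]; split;
    [left|move=> /= yx;
    apply: wx; rewrite -yx].
rewrite (_ : _ `&` _ = [set x]) ?esum_set1//.
by apply/seteqP; split=> [y []//|_ ->]; split => //; right.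
Qed.

End point_measure.

(** * Metric preliminaries and avoidance events *)

Section metric_sets.
Context {R : realType} (X : pmetricType R).
Implicit Types (A K : set X) (w : config X).

Lemma small_inv (r : R) : 0 < r -> exists n : nat, n.+1%:R^-1 < r.
Proof. by move=> /ltr_add_invr[n]; rewrite add0r; exists n. Qed.

Lemma inv_succ_gt0 n : (0 : R) < n.+1%:R^-1.
Proof. by rewrite invr_gt0. Qed.

Lemma open_metric_ball (x : X) (r : R) : open (ball x r).
Proof.
rewrite openE => y; rewrite ballEmdist/= => xyr.
apply/nbhs_ballP; exists (r - mdist x y) => /=; first by rewrite subr_gt0.
move=> z; rewrite !ballEmdist/= ltrBrDl => yz.
exact: le_lt_trans (metric_triangle x y z) yz.
Qed.

Definition thicken A (r : R) : set X := \bigcup_(x in A) ball x r.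

Lemma open_thicken A r : open (thicken A r).
Proof. by apply: bigcup_open => x _; exact: open_metric_ball. Qed.

Lemma sub_thicken A r : 0 < r -> A `<=` thicken A r.
Proof. by move=> r0 x Ax; exists x => //; exact: ballxx. Qed.

(** A Lebesgue number, taken along the sequence 1/(m+1) because unions over m
    must stay countable. *)
Lemma thicken_compact_sub K (V : set X) : compact K -> open V -> K `<=` V ->
  exists m : nat, thicken K m.+1%:R^-1 `<=` V.
Proof.
move=> /compact_near_coveringP cK oV KV.
have := cK _ \oo (fun n x => ball x (n.+1%:R^-1) `<=` V) _ _.
case.
- move=> x /KV; move: oV; rewrite openE => /[apply].
  rewrite /interior => /nbhs_ballP[e /= e0 xeV].
  have [N Ne] := @small_inv (e / 2) ltac:(by rewrite divr_gt0).
  exists (ball x (e / 2), [set n | (N <= n)%N]) => /=.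
    by split; [apply: nbhsx_ballx; rewrite divr_gt0|exists N].
  move=> [y n] [/= xy Nn] z yz; apply: xeV.
  rewrite [e]splitr; apply: ball_triangle xy _.
  apply: le_ball yz; rewrite (le_trans _ (ltW Ne))//.
  by rewrite lef_pV2 ?posrE// ler_nat ltnS.
- by move=> N _ /(_ N (leqnn _)) KN; exists N => y [x /KN]; exact.
Qed.

Lemma compact_bigsetU n (C : nat -> set X) : (forall k, compact (C k)) ->
  compact (\big[setU/set0]_(k < n) C k).
Proof.
move=> cC; elim/big_ind : _; first exact: compact0.
  exact: compactU.
by move=> k _.
Qed.

Lemma compact_setD_open K (U : set X) : compact K -> open U ->
  compact (K `\` U).
Proof.
move=> cK oU; apply: (subclosed_compact _ cK); last by move=> x [].
apply: closedI; last exact: open_closedC.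
by apply: compact_closed => //; exact: (@metric_hausdorff R X).
Qed.

(** A difference of compact sets need not be compact. Removing shrinking open
    neighbourhoods of [L] exhausts it by compact sets at positive distance from
    [L], which is how independence over disjoint compact sets reaches K \ L. *)
Lemma compact_setD_exhaust K L : compact K -> compact L ->
  exists C : nat -> set X, [/\ forall n, compact (C n),
    nondecreasing_seq C & \bigcup_n C n = K `\` L].
Proof.
move=> cK cL; exists (fun n => K `\` thicken L n.+1%:R^-1); split.
- by move=> n; apply: compact_setD_open => //; exact: open_thicken.
- move=> m n mn; apply/subsetPset => x [Kx nLx]; split => //.
  apply: contra_not nLx => -[y Ly yx]; exists y => //.
  by apply: le_ball yx; rewrite lef_pV2 ?posrE// ler_nat ltnS.
- apply/seteqP; split=> [x [n _ [Kx nLx]]|x [Kx nLx]].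
    split => //; apply: contra_not nLx; apply: sub_thicken; exact: inv_succ_gt0.
  have [||n Ln] := @thicken_compact_sub L (~` [set x]) cL.
  + apply: closed_openC; apply: compact_closed; last exact: compact_set1.
    exact: (@metric_hausdorff R X).
  + by move=> y Ly /= yx; apply: nLx; rewrite -yx.
  + by exists n => //; split => // /Ln /(_ erefl).
Qed.

(** Pieces are differences of compact sets rather than Borel sets so that the
    emptiness of a configuration on a piece only involves compact sets. *)
Lemma compact_partition K (r : R) : compact K -> 0 < r ->
  exists P : nat -> set X, [/\
    forall j, exists C C', [/\ compact C, compact C' & P j = C `\` C'],
    trivIset setT P, \bigcup_j P j = K &
    forall j x y, P j x -> P j y -> ball x r y].
Proof.
move=> cK r0; have r4 : 0 < r / 2 / 2 by rewrite !divr_gt0.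
(* Radius r/4: the closure of such a ball lies in the ball of radius r/2, whose
   points are at distance less than r from each other. *)
have clball (c x : X) : closure (ball c (r / 2 / 2)) x -> ball c (r / 2) x.
  move=> /(_ (ball x (r / 2 / 2)) (nbhsx_ballx _ _ r4))[z [cz xz]].
  by rewrite [r / 2]splitr; exact: ball_triangle cz (ball_sym xz).
have [D KD] : exists D : {fset X},
    K `<=` \bigcup_(c in [set` D]) ball c (r / 2 / 2).
  have := cK; rewrite compact_cover =>
    /(_ X setT (fun c => ball c (r / 2 / 2))).
  case=> [c _|x Kx|D _ KD]; [exact: open_metric_ball| |by exists D].
  by exists x => //; exact: ballxx.
pose C j := K `&` closure (ball (nth point (enum_fset D) j) (r / 2 / 2)).
have cC j : compact (C j).
  apply: (subclosed_compact _ cK); last by move=> x [].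
  apply: closedI; last exact: closed_closure.
  by apply: compact_closed => //; exact: (@metric_hausdorff R X).
exists (seqDU C); split.
- move=> j; exists (C j), (\big[setU/set0]_(k < j) C k).
  by split => //; exact: compact_bigsetU.
- exact: trivIset_seqDU.
- rewrite -seqDU_bigcup_eq; apply/seteqP; split=> [x [j _ []]//|x Kx].
  have [c /= cD cx] := KD _ Kx; exists (index c D) => //; split => //.
  by rewrite nth_index//; exact: subset_closure.
- move=> j x y /(@subset_seqDU _ C) [_ /clball jx].
  move=> /(@subset_seqDU _ C) [_ /clball jy].
  by rewrite [r]splitr; exact: ball_triangle (ball_sym jx) jy.
Qed.

Lemma finite_set_separated (F : set X) : finite_set F ->
  exists m : nat, forall x y, F x -> F y -> ball x m.+1%:R^-1 y -> x = y.
Proof.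
move=> /finite_seqP[s ->].
suff [m mP] : exists m : nat, forall p : X * X,
    p \in [seq (x, y) | x <- s, y <- s] -> ball p.1 m.+1%:R^-1 p.2 -> p.1 = p.2.
  exists m => x y /= xs ys; apply: (mP (x, y)).
  by apply/allpairsP; exists (x, y).
elim: [seq _ | _ <- _, _ <- _] => [|[x y] t [m IH]]; first by exists 0%N.
have [xy|/eqP xy] := eqVneq x y.
  exists m => p; rewrite inE => /predU1P[->//|]; exact: IH.
have [k kxy] : exists k : nat, k.+1%:R^-1 < mdist x y.
  by apply: small_inv; rewrite mdist_gt0; exact/eqP.
exists (maxn k m) => p; rewrite inE => /predU1P[->/=|pt pm].
  rewrite ballEmdist/= => xyk; exfalso; move: xyk; apply/negP.
  rewrite -leNgt (le_trans _ (ltW kxy))// lef_pV2 ?posrE// ler_nat ltnS.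
  exact: leq_maxl.
apply: IH pt _; apply: le_ball pm.
by rewrite lef_pV2 ?posrE// ler_nat ltnS leq_maxr.
Qed.

(** The finitely many points of a configuration in a compact set are separated
    at some scale, so that smaller sets contain one of them at most. *)
Lemma config_measure_le1_fine w K : compact K ->
  exists m : nat, forall A : set (borel X), A `<=` K ->
    (forall x y, A x -> A y -> ball (x : X) m.+1%:R^-1 y) ->
    (config_measure w A <= 1)%E.
Proof.
move=> /(config_compact_finite w)/finite_set_separated[m mP].
exists m => A AK Am; apply: config_measure_le1 => x y wx Ax wy Ay.
by apply: mP; [split => //; exact: AK|split => //; exact: AK|exact: Am].
Qed.

End metric_sets.

Section void_events.
Context {R : realType} (X : pmetricType R).
Local Open Scope ereal_scope.

Definition void_event (A : set X) : set (config X) :=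
  [set w | config_measure w A = 0].

Definition void_events : set (set (config X)) :=
  [set void_event K | K in compact].

Lemma void_event0 : void_event set0 = setT.
Proof.
by apply/seteqP; split => // w _; apply/config_measure_eq0; rewrite setI0.
Qed.

Lemma void_eventU (A B : set X) :
  void_event (A `|` B) = void_event A `&` void_event B.
Proof.
apply/seteqP; split=> w; rewrite /void_event/= !config_measure_eq0.
  by rewrite setIUr setU_eq0.
by move=> [wA wB]; rewrite setIUr wA wB setU0.
Qed.

Lemma void_event_bigcup (A : nat -> set X) :
  void_event (\bigcup_n A n) = \bigcap_n void_event (A n).
Proof.
apply/seteqP; split=> w; rewrite /void_event/= !config_measure_eq0.
  move=> wA n _; apply/config_measure_eq0; apply/seteqP; split=> // x [wx Ax].
  by rewrite -wA; split => //; exists n.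
move=> wA; apply/seteqP; split=> // x [wx [n _ Ax]].
have /config_measure_eq0 wAn := wA n I.
have : (points w `&` A n) x by [].
by rewrite wAn.
Qed.

Lemma void_events_setI : setI_closed void_events.
Proof.
move=> _ _ [K cK <-] [L cL <-]; exists (K `|` L); first exact: compactU.
exact: void_eventU.
Qed.

Local Notation OmegaV := (g_sigma_algebraType void_events).

Let measurable_void_compact (K : set X) : compact K ->
  measurable (void_event K : set OmegaV).
Proof. by move=> cK; apply: sub_gen_smallest; exists K. Qed.

Let measurable_void_setD (K L : set X) : compact K -> compact L ->
  measurable (void_event (K `\` L) : set OmegaV).
Proof.
move=> cK cL; have [C [cC _ <-]] := compact_setD_exhaust cK cL.
by rewrite void_event_bigcup; apply: bigcapT_measurable => n;
  exact: measurable_void_compact.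
Qed.

(** Each occupied piece of a partition of K contains a point, and at a fine
    scale exactly one; hence the number of points in K is the supremum over the
    scales of the number of occupied pieces. *)
Let measurable_count (K : set X) : compact K ->
  measurable_fun setT (fun w : OmegaV => config_measure (w : config X) K).
Proof.
move=> cK.
have /choice[P PP] : forall m : nat, exists P : nat -> set X, [/\
    forall j, exists C C', [/\ compact C, compact C' & P j = C `\` C'],
    trivIset setT P, \bigcup_j P j = K &
    forall j x y, P j x -> P j y -> ball x (m.+1%:R^-1 : R) y].
  by move=> m; apply: compact_partition => //; exact: inv_succ_gt0.
have mP m j : measurable (P m j : set (borel X)).
  have [/(_ j)[C [C' [cC cC' ->]]] _ _ _] := PP m.
  by apply: measurableD; exact: compact_measurable_borel.
have KP m w : config_measure w K = \sum_(j <oo) config_measure w (P m j).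
  have [_ tP UP _] := PP m; rewrite -UP measure_bigcup//.
    by apply: eq_eseriesl => j; rewrite in_setT.
pose f m (w : OmegaV) : \bar R :=
  \sum_(j <oo) (\1_(~` void_event (P m j)) w)%:E.
have mf m : measurable_fun setT (f m).
  apply: ge0_emeasurable_sum => // j _.
  apply/measurable_EFinP/measurable_indicP; apply: measurableC.
  have [/(_ j)[C [C' [cC cC' ->]]] _ _ _] := PP m.
  exact: measurable_void_setD.
have f1 m j w : ((\1_(~` void_event (P m j)) w)%:E <= config_measure w (P m j)).
  rewrite indicE; case: (boolP (_ \in _)) => [|_]; last exact: measure_ge0.
  rewrite inE => /= /eqP w0; have : points w `&` P m j <> set0.
    by move=> /config_measure_eq0 w0'; move: w0; rewrite /void_event/= w0' eqxx.
  by move=> /eqP/set0P[x [wx Px]]; exact: config_measure_ge1 wx Px.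
rewrite (_ : (fun w => _) = (fun w => esups (f ^~ w) 0%N)).
  exact: measurable_fun_esups.
apply/funext => w; apply/eqP; rewrite eq_le; apply/andP; split.
  have [m wm] := config_measure_le1_fine w cK.
  apply: ereal_sup_ge; exists (f m w); first by exists m.
  rewrite (KP m); apply: lee_nneseries => // j _.
  rewrite indicE; case: (boolP (_ \in _)) => [_|].
    apply: wm => [x|]; last by have [_ _ _] := PP m; exact.
    by have [_ _ <- _] := PP m => Px; exists j.
  by rewrite notin_setE/= => /contrapT ->.
apply: ge_ereal_sup => _ [m _ <-]; rewrite (KP m).
by apply: lee_nneseries => // j _; exact: f1.
Qed.

(** Rényi's observation. Since avoidance events are stable under
    intersection, two laws with equal avoidance probabilities on compact sets
    coincide. *)
Lemma measurable_void_events :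
  @measurable _ (Omega X) = <<s void_events >>.
Proof.
apply/seteqP; split; apply: smallest_sub => //;
  try exact: smallest_sigma_algebra.
  move=> A [K cK [B mB <-]].
  by have := measurable_count cK measurableT mB.
move=> _ [K cK <-]; apply: sub_gen_smallest; exists K => //.
exists [set 0]; first exact: emeasurable_set1.
by rewrite setTI.
Qed.

Lemma measurable_void_event_compact (K : set X) : compact K ->
  measurable (void_event K : set (Omega X)).
Proof.
by move=> cK; rewrite measurable_void_events; apply: sub_gen_smallest; exists K.
Qed.

End void_events.

(** * The kernel of point measures *)

Lemma sigma_compact_nondecreasing (X : topologicalType) : sigma_compact X ->
  exists K : nat -> set X, [/\ forall n, compact (K n), nondecreasing_seq K &
    \bigcup_n K n = setT].
Proof.
move=> [K cK UK]; exists (fun n => \big[setU/set0]_(k < n.+1) K k); split.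
- move=> n; elim/big_ind : _; [exact: compact0|exact: compactU|by move=> k _].
- by move=> m n mn; exact/subsetPset/subset_bigsetU.
- apply/seteqP; split=> // x _; have := subsetT [set x].
  rewrite -UK => /(_ x erefl)[n _ Knx]; exists n => //.
  by rewrite -bigcup_mkord; exists n => /=.
Qed.

Section configuration_kernel.
Context {R : realType} (X : pmetricType R).
Hypothesis sX : sigma_compact X.
Local Open Scope ereal_scope.

(** Compact sets generate because an open set is the complement of a countable
    union of compact sets. Unlike open sets, they have a finite number of
    points and a finite intensity. *)
Lemma borel_compact : @measurable _ (borel X) = <<s (@compact X) >>.
Proof.
apply/seteqP; split; apply: smallest_sub => //;
  try exact: smallest_sigma_algebra.
- move=> U oU; have [K [cK _ UK]] := sigma_compact_nondecreasing sX.
  rewrite -[U]setCK -[~` (~` U)]setTD; apply: sigma_algebraCD.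
  rewrite -[~` U]setIT -UK setI_bigcupr; apply: sigma_algebra_bigcup => n.
  apply: sub_sigma_algebra; rewrite setIC -setDE; exact: compact_setD_open.
- by move=> K cK; exact: (compact_measurable_borel cK).
Qed.

Lemma compact_setI_closed : setI_closed (@compact X).
Proof.
move=> A B cA cB; apply: (subclosed_compact _ cA); last by move=> x [].
by apply: closedI; apply: compact_closed => //; exact: (@metric_hausdorff R X).
Qed.

(** Cutting by a compact set makes the point measures finite, so that the
    sets with a measurable count form a Dynkin class. *)
Lemma measurable_config_measure (A : set (borel X)) : measurable A ->
  measurable_fun setT (fun w : Omega X => config_measure (w : config X) A).
Proof.
have mcompact (L : set X) : compact L ->
    measurable_fun setT (fun w : Omega X => config_measure (w : config X) L).
  move=> cL _ B mB; apply: sub_gen_smallest; exists L => //; exists B => //.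
have mI (L : set X) : compact L -> forall A : set (borel X), measurable A ->
    measurable_fun setT (fun w : Omega X =>
      config_measure (w : config X) (A `&` L)).
  move=> cL B mB; move: (mB); rewrite borel_compact.
  have mL := compact_measurable_borel cL.
  apply: (@dynkin_induction _ (borel X) (@compact X)
    (fun A => measurable_fun setT (fun w : Omega X =>
      config_measure (w : config X) (A `&` L)))).
  - exact: borel_compact.
  - exact: compact_setI_closed.
  - by rewrite setTI; exact: mcompact.
  - by move=> C cC; apply: mcompact; exact: compact_setI_closed.
  - move=> S mS mSL.
    rewrite (_ : (fun w => _) = (fun w : Omega X =>
      config_measure (w : config X) L - config_measure (w : config X)
        (S `&` L))).
      by apply: emeasurable_funB => //; exact: mcompact.
    apply/funext => w; rewrite setIC -setDE measureD//.
      by rewrite [in RHS]setIC.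
    exact: config_measure_compact.
  - move=> F mF tF mFL.
    rewrite (_ : (fun w => _) = (fun w : Omega X =>
      \sum_(n <oo) config_measure (w : config X) (F n `&` L))).
      by apply: ge0_emeasurable_sum => // n _; exact: mFL.
    apply/funext => w; rewrite setI_bigcupl measure_bigcup//.
    + by apply: eq_eseriesl => n; rewrite in_setT.
    + by move=> n _; exact: measurableI.
    + exact: trivIset_setIr.
have [K [cK ndK UK]] := sigma_compact_nondecreasing sX => mA.
have mK n := compact_measurable_borel (cK n).
apply: (emeasurable_fun_cvg
  (fun n (w : Omega X) => config_measure (w : config X) (A `&` K n))).
  by move=> n; exact: mI.
move=> w _; have := @nondecreasing_cvg_mu _ (borel X) R (config_measure w)
  (fun n => A `&` K n).
rewrite -setI_bigcupr UK setIT; apply => //.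
- by move=> n; exact: measurableI.
- by move=> m n mn; apply/subsetPset; apply: setIS; exact/subsetPset/ndK.
Qed.

Section kernel.
Import HBNNSimple.
Context d (Z : measurableType d).
Variable W : Z -> Omega X.
Hypothesis mW : measurable_fun setT W.

(** The kernel is pulled back along an arbitrary map [W] because the integrands
    below depend, besides the configuration, on a varying number of points. *)
Definition config_kernel (z : Z) : {measure set (borel X) -> \bar R} :=
  config_measure (W z : config X).

Let measurable_config_kernel (A : set (borel X)) : measurable A ->
  measurable_fun setT (config_kernel ^~ A).
Proof.
by move=> mA; apply: (measurableT_comp (measurable_config_measure mA)).
Qed.

HB.instance Definition _ := isKernel.Build _ _ Z (borel X) R
  config_kernel measurable_config_kernel.

(** The mass of a compact set is finite for each configuration without being
    uniformly bounded; it is enough to bound it pointwise. *)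
Lemma measurable_config_xsection (C : set (Z * borel X)) : measurable C ->
  measurable_fun setT (fun z => config_measure (W z : config X) (xsection C z)).
Proof.
move=> mC; have [K [cK ndK UK]] := sigma_compact_nondecreasing sX.
have mK n := compact_measurable_borel (cK n).
apply: (emeasurable_fun_cvg
  (fun n z => mrestr (config_kernel z) (mK n) (xsection C z))).
  move=> n; have [|_] := @measurable_prod_subset_xsection_kernel _ _ _ _ _
    (config_kernel : R.-ker Z ~> borel X) _ (mK n) _ C mC; last exact.
  move=> z; have := config_measure_compact (W z) (cK n).
  move/config_measure_nat => [k zk]; exists (k.+1%:R) => A mA.
  rewrite /mrestr (le_lt_trans (le_measure _ _ _ (@subIsetr _ _ _)))//= ?inE//.
    exact: measurableI.
  by rewrite /config_kernel zk lte_fin ltr_nat.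
move=> z _; have := @nondecreasing_cvg_mu _ (borel X) R
  (config_measure (W z : config X))
  (fun n => xsection C z `&` K n).
have mCz : measurable (xsection C z) by exact: measurable_xsection.
rewrite -setI_bigcupr UK setIT; apply => //.
- by move=> n; exact: measurableI.
- by move=> m n mn; apply/subsetPset; apply: setIS; exact/subsetPset/ndK.
Qed.

Lemma measurable_config_integral (h : Z * borel X -> \bar R) :
  (forall z, 0 <= h z) -> measurable_fun setT h ->
  measurable_fun setT (fun z => \int[config_measure (W z : config X)]_x h
    (z, x)).
Proof.
move=> h0 mh; pose h_ := nnsfun_approx measurableT mh.
apply: (@measurable_fun_xsection_integral _ _ _ _ _ h config_kernel h_).
- by move=> a b ab; exact/nd_nnsfun_approx.
- by move=> z; exact/cvg_nnsfun_approx.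
- by move=> n r; exact: measurable_config_xsection.
Qed.

End kernel.

(** Only avoidance events have to be tested, and adding [x] avoids K exactly
    when the configuration does and [x] is outside K. *)
Lemma measurable_add_point :
  measurable_fun setT (fun p : (Omega X * borel X)%type =>
    add_point p.1 p.2 : Omega X).
Proof.
apply: (measurability _ (measurable_void_events X)).
move=> _ [_ [K cK <-] <-].
have -> : [set: Omega X * borel X] `&`
    (fun p : (Omega X * borel X)%type => add_point p.1 p.2) @^-1` void_event K
    = void_event K `*` (~` K).
  apply/seteqP; split=> [[w x]/= [_ ]|[w x] /= []].
    rewrite /void_event/= !config_measure_eq0 setIUl setU_eq0 => -[-> xK].
    by split => // Kx; have : ([set x] `&` K) x by []; rewrite xK.
  move=> /config_measure_eq0 wK nKx; split => //; apply/config_measure_eq0.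
  by rewrite setIUl wK set0U; apply/seteqP; split => // _ [-> ].
apply: measurableX; last first.
  by apply: measurableC; exact: compact_measurable_borel.
by rewrite measurable_void_events; apply: sub_gen_smallest; exists K.
Qed.

End configuration_kernel.

(** * The mean of a Poisson variable *)

Section poisson_mean.
Context {R : realType} d (T : measurableType d) (P : probability T R).
Local Open Scope ereal_scope.

(** Dropping the null term and dividing by k shifts the series to the
    exponential one. *)
Let poisson_mean_series (q lam : R) :
  \sum_(k <oo) (k%:R * (q * (expR (- lam) * lam ^+ k / k`!%:R)))%:E =
  (q * lam)%:E.
Proof.
apply/cvg_lim => //.
rewrite -(cvg_shiftS (fun n => \sum_(0 <= k < n) (k%:R *
  (q * (expR (- lam) * lam ^+ k / k`!%:R)))%:E)).
rewrite (_ : (fun n => _) = (fun n =>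
    (q * expR (- lam) * lam * series (exp_coeff lam) n)%:E)); last first.
  apply/funext => n; rewrite sumEFin; congr EFin.
  rewrite big_nat_recl// mul0r add0r /series/= mulr_sumr.
  apply: eq_bigr => k _; rewrite /exp_coeff/= factS natrM exprS.
  by field; rewrite nat1r !pnatr_eq0 -lt0n fact_gt0.
rewrite (_ : (q * lam)%R = (q * expR (- lam) * lam * expR lam)%R); last first.
  by rewrite -[LHS]mulr1 -(expRxMexpNx_1 lam); ring.
apply: cvg_EFin; first by near=> n.
by apply: cvgMr; exact: is_cvg_series_exp_coeff.
Unshelve. all: by end_near. Qed.

(** With q the probability of [D], the hypothesis says that [N] is a Poisson
    variable of parameter [lam] independent of [D]. *)
Lemma integral_poisson_mean (N : T -> \bar R) (D : set T) (q lam : R) :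
  measurable_fun setT N -> measurable D ->
  (forall t, exists n : nat, N t = n%:R%:E) ->
  (forall k : nat, P (N @^-1` [set k%:R%:E] `&` D) =
    (q * (expR (- lam) * lam ^+ k / k`!%:R))%:E) ->
  \int[P]_(t in D) N t = (q * lam)%:E.
Proof.
move=> mN mD Nnat PN.
have mNk (k : nat) : measurable (N @^-1` [set k%:R%:E] `&` D).
  by apply: measurableI => //; rewrite -[X in measurable X]setTI; exact: mN.
have -> : D = \bigcup_k (N @^-1` [set k%:R%:E] `&` D).
  apply/seteqP; split=> [t Dt|t [k _ []]//].
  by have [n Nt] := Nnat t; exists n.
rewrite ge0_integral_bigcup//.
- rewrite -poisson_mean_series; apply: eq_eseriesr => k _.
  rewrite (eq_integral (cst k%:R%:E)); last by move=> t; rewrite inE => -[].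
  rewrite integral_cst//. rewrite [X in _ * X](PN k) -EFinM. by [].
- exact: measurable_funTS.
- by move=> t _; have [n ->] := Nnat t; rewrite lee_fin.
- move=> i j _ _ [t [[/= -> _] [/= + _]]].
  by move=> [] /eqP; rewrite eqr_nat => /eqP.
Qed.

End poisson_mean.

(** * Avoidance probabilities and independence *)

Lemma measurable_prod_generated d1 d2 (T1 : measurableType d1)
    (T2 : measurableType d2) (G1 : set (set T1)) (G2 : set (set T2))
    (g1 : nat -> set T1) (g2 : nat -> set T2) :
  @measurable _ T1 = <<s G1 >> -> @measurable _ T2 = <<s G2 >> ->
  (forall n, G1 (g1 n)) -> \bigcup_n g1 n = setT ->
  (forall n, G2 (g2 n)) -> \bigcup_n g2 n = setT ->
  @measurable _ (T1 * T2)%type = <<s [set A `*` B | A in G1 & B in G2] >>.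
Proof.
move=> mG1 mG2 Gg1 Ug1 Gg2 Ug2; set G := [set _ | _ in _ & _ in _].
apply/seteqP; split; last first.
  apply: smallest_sub; first exact: sigma_algebra_measurable.
  move=> _ [A GA [B GB <-]]; apply: measurableX.
    by rewrite mG1; exact: sub_gen_smallest.
  by rewrite mG2; exact: sub_gen_smallest.
pose TG := g_sigma_algebraType (G : set (set (T1 * T2)%type)).
have m1 : measurable_fun setT (fst : TG -> T1).
  apply: (measurability _ mG1) => _ [A GA <-].
  rewrite setTI (_ : fst @^-1` A = \bigcup_n (A `*` g2 n)).
    apply: bigcupT_measurable => n; apply: sub_gen_smallest.
    by exists A => //; exists (g2 n).
  apply/seteqP; split=> [[x y] /= Ax|[x y] [n _ []]//].
  have : (\bigcup_n g2 n) y by rewrite Ug2.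
  by move=> [n _ yn]; exists n.
have m2 : measurable_fun setT (snd : TG -> T2).
  apply: (measurability _ mG2) => _ [A GA <-].
  rewrite setTI (_ : snd @^-1` A = \bigcup_n (g1 n `*` A)).
    apply: bigcupT_measurable => n; apply: sub_gen_smallest.
    by exists (g1 n) => //; exists A.
  apply/seteqP; split=> [[x y] /= Ax|[x y] [n _ []]//].
  have : (\bigcup_n g1 n) x by rewrite Ug1.
  by move=> [n _ xn]; exists n.
move=> A mA.
have := measurable_fun_pair m1 m2 measurableT mA; rewrite setTI.
by congr (measurable _); apply/seteqP; split=> -[].
Qed.

Section poisson_configuration.
Context {R : realType} (X : pmetricType R).
Variables (sigma : {sigma_finite_measure set (borel X) -> \bar R})
  (P : probability (Omega X) R).
Hypothesis poiP : is_poisson_measure sigma P.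
Local Open Scope ereal_scope.

Lemma poisson_law_compact (K : set X) : compact K ->
  poisson_law P (fun w : Omega X => config_measure (w : config X) K) (sigma K).
Proof.
move=> cK; have [||_ /(_ ord0)//] := @poiP 1%N (fun=> K); first by [].
by move=> i j _ _ _; rewrite !ord1.
Qed.

Lemma poisson_intensity_fin_num (K : set X) : compact K ->
  sigma K \is a fin_num.
Proof. by case/poisson_law_compact. Qed.

Lemma poisson_void_event (K : set X) : compact K ->
  P (void_event K) = (expR (- fine (sigma K)))%:E.
Proof.
case/poisson_law_compact => _ /(_ 0%N).
by rewrite expr0 mulr1 fact0 divr1.
Qed.

Lemma poisson_independent_void (A K : set X) (k : nat) :
  compact A -> compact K -> A `&` K = set0 ->
  P ((fun w : Omega X => config_measure (w : config X) A) @^-1` [set k%:R%:E]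
      `&` void_event K) =
  P ((fun w : Omega X => config_measure (w : config X) A) @^-1` [set k%:R%:E])
    * P (void_event K).
Proof.
move=> cA cK AK; pose S (i : 'I_2) := if val i == 0%N then A else K.
have [||indep _] := @poiP 2%N S.
- by move=> i; rewrite /S; case: ifP.
- move=> [[|[|//]] i] [[|[|//]] j] _ _; rewrite /S/=.
  + by move=> _; exact: val_inj.
  + by rewrite AK => -[].
  + by rewrite setIC AK => -[].
  + by move=> _; exact: val_inj.
pose B (i : 'I_2) : set (\bar R) :=
  if val i == 0%N then [set k%:R%:E] else [set 0].
have := indep finset.setT B.
rewrite (eq_bigl xpredT); last by move=> i; rewrite finset.in_setT.
rewrite big_ord_recl big_ord1 /= => <-; last first.
  by move=> i; rewrite /B; case: ifP => _; exact: emeasurable_set1.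
congr (P _); apply/seteqP; split=> w.
  by move=> [wA wK] [[|[|//]] i] _.
move=> wi; split; first exact: (wi ord0 (finset.in_setT _)).
exact: (wi (lift ord0 ord0) (finset.in_setT _)).
Qed.

Hypothesis sX : sigma_compact X.

(** If w avoids K, its points in A are those in A \ K. The latter set is
    exhausted by compact sets disjoint from K, whose point counts are
    independent of the avoidance of K. *)
Lemma integral_config_void (A K : set X) : compact A -> compact K ->
  \int[P]_(w in void_event K) config_measure (w : config X) A =
  P (void_event K) * sigma (A `\` K).
Proof.
move=> cA cK; have [C [cC ndC UC]] := compact_setD_exhaust cA cK.
have mC n := compact_measurable_borel (cC n).
have mA := compact_measurable_borel cA.
have mK := compact_measurable_borel cK.
have mcC n := @measurable_config_measure _ X sX _ (mC n).
have CK n : C n `&` K = set0.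
  apply/seteqP; split=> // x [Cx Kx].
  have : (\bigcup_n C n) x by exists n.
  by rewrite UC => -[].
transitivity (\int[P]_(w in void_event K) limn (fun n =>
    config_measure (w : config X) (C n))).
  apply: eq_integral => w; rewrite inE => wK.
  have -> : config_measure w A = config_measure w (A `\` K).
    rewrite !config_measureE; congr esum; apply/seteqP;
      split=> [x [wx Ax]|x [wx [Ax _]]//].
    split => //; split => // Kx; move/config_measure_eq0 : wK.
    by move=> wK; have : (points w `&` K) x by []; rewrite wK.
  apply/esym/cvg_lim => //; rewrite -UC; apply: nondecreasing_cvg_mu => //.
  exact: bigcupT_measurable.
rewrite monotone_convergence//; last 3 first.
- exact: measurable_void_event_compact.
- by move=> n; apply: measurable_funTS; exact: mcC.
- move=> w _ m n mn; apply: le_measure; rewrite ?inE//.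
  exact/subsetPset/ndC.
apply/cvg_lim => //; rewrite -UC.
rewrite (_ : (fun n => _) = (fun n => P (void_event K) * sigma (C n))).
  apply: cvgeZl; first exact: fin_num_measure
    (measurable_void_event_compact cK).
  by apply: nondecreasing_cvg_mu => //; exact: bigcupT_measurable.
apply/funext => n; have [fC PC] := poisson_law_compact (cC n).
have fK := fin_num_measure P _ (measurable_void_event_compact cK).
rewrite -(fineK fK) -(fineK fC) -EFinM.
apply: integral_poisson_mean => //.
- exact: measurable_void_event_compact.
- by move=> w; exact/config_measure_nat/config_measure_compact.
- by move=> k; rewrite poisson_independent_void// PC -[in LHS](fineK fK) -EFinM
  mulrC.
Qed.

End poisson_configuration.

(** * Mecke's formula *)

Lemma pushforward_measure_ex d1 d2 (T1 : measurableType d1)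
    (T2 : measurableType d2) (R : realType) (m : {measure set T1 -> \bar R})
    (f : T1 -> T2) : measurable_fun setT f ->
  exists m' : {measure set T2 -> \bar R}, forall D, m' D = m (f @^-1` D).
Proof.
move=> mf.
by exists (measure_function_pushforward__canonical__measure_function_Measure m
  mf).
Qed.

Section mecke.
Import HBNNSimple.
Context {R : realType} (X : pmetricType R).
Variables (sigma : {sigma_finite_measure set (borel X) -> \bar R})
  (P : probability (Omega X) R).
Hypothesis sX : sigma_compact X.
Local Open Scope ereal_scope.
Local Notation T := (Omega X * borel X)%type.

(** The Campbell measure of the point process with law [P]. *)
Definition campbell (C : set T) : \bar R :=
  \int[P]_w config_measure (w : config X) (xsection C w).

Let mxsec (C : set T) : measurable C ->
  measurable_fun setT (fun w : Omega X =>
    config_measure (w : config X) (xsection C w)).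
Proof. by move=> mC; exact: (measurable_config_xsection sX (W := id)). Qed.

Let campbell0 : campbell set0 = 0.
Proof.
by rewrite /campbell integral0_eq// => w _; rewrite xsection0 measure0.
Qed.

Let campbell_ge0 C : 0 <= campbell C.
Proof. exact: integral_ge0. Qed.

Let campbell_sigma_additive : semi_sigma_additive campbell.
Proof.
move=> F mF tF mUF; apply: cvg_toP.
  by apply: is_cvg_ereal_nneg_natsum_cond => n _ _; exact: campbell_ge0.
rewrite /campbell -integral_nneseries//; last by move=> n; exact: mxsec.
apply: eq_integral => w _; rewrite xsection_bigcup measure_bigcup//.
- by apply: eq_eseriesl => n; rewrite in_setT.
- by move=> n _; exact: measurable_xsection.
- exact: trivIset_xsection.
Qed.

HB.instance Definition _ := isMeasure.Build _ _ _ campbell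
  campbell0 campbell_ge0 campbell_sigma_additive.

Let mint (h : T -> \bar R) : (forall z, 0 <= h z) -> measurable_fun setT h ->
  measurable_fun setT (fun w : Omega X =>
    \int[config_measure (w : config X)]_x h (w, x)).
Proof. by move=> h0 mh; exact: (measurable_config_integral sX (W := id)). Qed.

Let integral_campbell_nnsfun (f : {nnsfun T >-> R}) :
  \int[campbell]_z (f z)%:E =
  \int[P]_w \int[config_measure (w : config X)]_x (f (w, x))%:E.
Proof.
have mf r : measurable (f @^-1` [set r]) by [].
have fE z : (f z)%:E = \sum_(r \in range f) (r * \1_(f @^-1` [set r]) z)%:E.
  by rewrite fimfunE -fsumEFin.
have f0 r z : 0 <= (r * \1_(f @^-1` [set r]) z)%:E.
  by rewrite EFinM nnfun_muleindic_ge0.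
have mr r : measurable_fun setT (fun z : T => (r * \1_(f @^-1` [set r]) z)%:E).
  exact/measurable_EFinP/measurableT_comp.
have mrw r (w : Omega X) : measurable_fun setT
    (fun x : borel X => (r * \1_(f @^-1` [set r]) (w, x))%:E).
  by apply: measurableT_comp (mr r) _; exact: pair1_measurable.
under eq_integral do rewrite fE.
rewrite ge0_integral_fsum//.
under [RHS]eq_integral => w _.
  under eq_integral do rewrite fE.
  rewrite ge0_integral_fsum//.
  over.
rewrite ge0_integral_fsum//; last 2 first.
- by move=> r; exact: (mint (h := fun z => (r * \1_(f @^-1` [set r]) z)%:E)).
- by move=> r w _; apply: integral_ge0 => x _; exact: f0.
apply: eq_fsbigr => r _; have [r0|r0] := ltP r 0%R.
  have fr0 : f @^-1` [set r] = set0 by exact: preimage_nnfun0.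
  rewrite integral0_eq; last by move=> z _; rewrite fr0 indic0 mulr0.
  rewrite integral0_eq// => w _.
  by rewrite integral0_eq// => x _; rewrite fr0 indic0 mulr0.
under eq_integral do rewrite EFinM.
rewrite ge0_integralZl//; last exact/measurable_EFinP.
rewrite integral_indic// setIT /= /campbell -ge0_integralZl//; last first.
  exact: mxsec.
apply: eq_integral => w _; under eq_integral do rewrite EFinM.
have mix : measurable_fun setT (fun x : borel X =>
    \1_(f @^-1` [set r]) (w, x) : R).
  by apply: measurableT_comp (pair1_measurable w).
rewrite ge0_integralZl//; last exact/measurable_EFinP.
congr (_ * _).
transitivity (\int[config_measure (w : config X)]_x
    (\1_(xsection (f @^-1` [set r]) w) x)%:E).
  by rewrite integral_indic ?setIT//; exact: measurable_xsection.
by apply: eq_integral => x _; rewrite !indicE mem_xsection.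
Qed.

Lemma integral_campbell (h : T -> \bar R) :
  (forall z, 0 <= h z) -> measurable_fun setT h ->
  \int[campbell]_z h z =
  \int[P]_w \int[config_measure (w : config X)]_x h (w, x).
Proof.
move=> h0 mh; pose h_ := nnsfun_approx measurableT mh.
have cvgh z : limn (fun n => (h_ n z)%:E) = h z.
  by apply/cvg_lim => //; exact: cvg_nnsfun_approx.
have ndh z : nondecreasing_seq (fun n => (h_ n z)%:E).
  by move=> m n mn; rewrite lee_fin; exact/lefP/nd_nnsfun_approx.
have mhw n (w : Omega X) :
    measurable_fun setT (fun x : borel X => (h_ n (w, x))%:E).
  by apply/measurable_EFinP; apply: measurableT_comp (pair1_measurable w).
under eq_integral do rewrite -cvgh.
rewrite monotone_convergence//; last 2 first.
- by move=> n; exact/measurable_EFinP.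
- by move=> n z _; rewrite lee_fin.
under eq_fun do rewrite integral_campbell_nnsfun.
rewrite -monotone_convergence//; last 3 first.
- move=> n; apply: (mint (h := fun z => (h_ n z)%:E)).
    by move=> z; rewrite lee_fin.
  exact/measurable_EFinP.
- by move=> n w _; apply: integral_ge0 => x _; rewrite lee_fin.
- move=> w _ m n mn; apply: ge0_le_integral => //.
  + by move=> x _; rewrite lee_fin.
  + by move=> x _; exact: ndh.
apply: eq_integral => w _; rewrite -monotone_convergence//.
- by apply: eq_integral => x _; rewrite cvgh.
- by move=> n x _; rewrite lee_fin.
Qed.

Hypothesis poiP : is_poisson_measure sigma P.

Let addp (p : T) : T := (add_point p.1 p.2, p.2).

Let maddp : measurable_fun setT addp.
Proof. by apply: measurable_fun_pair => //; exact: measurable_add_point. Qed.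

Let campbell_rect (K A : set X) : compact K -> compact A ->
  campbell (void_event K `*` A) = P (void_event K) * sigma (A `\` K).
Proof.
move=> cK cA; rewrite -(integral_config_void poiP)// /campbell.
rewrite [RHS]integral_mkcond; apply: eq_integral => w _; rewrite patchE.
case: ifPn => [wK|wK]; first by rewrite in_xsectionX.
by rewrite notin_xsectionX//; exact: measure0.
Qed.

Let addp_rect (K A : set X) : compact K -> compact A ->
  (P \x sigma) (addp @^-1` (void_event K `*` A)) =
  P (void_event K) * sigma (A `\` K).
Proof.
move=> cK cA.
have mK := compact_measurable_borel cK; have mA := compact_measurable_borel cA.
rewrite -product_measure1E//; [|exact: measurable_void_event_compact|exact:
  measurableD].
congr product_measure1; apply/seteqP; split=> -[w x]; rewrite /addp/=.
  move=> [/config_measure_eq0 /=]; rewrite setIUl setU_eq0 => -[wK xK] Ax.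
  split; first exact/config_measure_eq0.
  by split => // Kx; have : ([set x] `&` K) x by []; rewrite xK.
move=> [/config_measure_eq0 wK [Ax nKx]]; split => //.
apply/config_measure_eq0; rewrite /= setIUl wK set0U.
by apply/seteqP; split => // _ [->].
Qed.

(** Avoidance events of compact sets times compact sets are stable under
    intersection, generate, and have finite mass over [K n]; on them both
    measures were computed above. *)
Let campbellE (C : set T) : measurable C ->
  campbell C = (P \x sigma) (addp @^-1` C).
Proof.
have [K [cK _ UK]] := sigma_compact_nondecreasing sX.
have mG := measurable_prod_generated (measurable_void_events X)
  (borel_compact sX) (T1 := Omega X) (T2 := borel X)
  (g1 := fun=> (@void_event R X set0 : set (Omega X))) (g2 := K).
have [mpush mpushE] := pushforward_measure_ex (P \x sigma) maddp.
pose mcamp := [the {measure set T -> \bar R} of campbell].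
move=> mC; rewrite -[LHS]/(mcamp C) -mpushE.
apply: (@measure_unique _ R T
  [set A `*` B | A in @void_events R X & B in @compact X]
  (fun n => void_event set0 `*` K n) _ _ _ _ mcamp mpush _ _ C mC).
- apply: mG => //; last by rewrite void_event0 bigcup_const.
  by move=> _; exists set0 => //; exact: compact0.
- move=> _ _ [_ [L cL <-] [A cA <-]] [_ [M cM <-] [B cB <-]].
  rewrite -setXI; exists (void_event L `&` void_event M).
    by apply: void_events_setI; [exists L|exists M].
  by exists (A `&` B) => //; exact: compact_setI_closed.
- move=> n; exists (void_event set0); first by exists set0 => //;
  exact: compact0.
  by exists (K n).
- by rewrite -setX_bigcupr UK void_event0 setXTT.
- move=> _ [_ [L cL <-] [A cA <-]].
  by rewrite mpushE [RHS]addp_rect//; exact: campbell_rect.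
- move=> n; rewrite [X in X < _](campbell_rect (@compact0 X) (cK n)).
  rewrite void_event0 probability_setT mul1e setD0.
  by rewrite ltey_eq (poisson_intensity_fin_num poiP).
Qed.

(** Mecke's formula: under a Poisson law, a point picked from the configuration
    behaves as a point added independently with the intensity. *)
Theorem mecke (h : T -> \bar R) :
  (forall z, 0 <= h z) -> measurable_fun setT h ->
  \int[P]_w \int[config_measure (w : config X)]_x h (w, x) =
  \int[P]_w \int[sigma]_x h (add_point w x, x).
Proof.
move=> h0 mh; rewrite -integral_campbell//.
transitivity (\int[pushforward (P \x sigma) addp]_z h z).
  by apply: eq_measure_integral => C mC _; exact: campbellE.
rewrite ge0_integral_pushforward// preimage_setT.
rewrite fubini_tonelli1//=.
by apply: measurableT_comp.
Qed.

End mecke.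

(** * Finite families of added points and acyclicity *)

Section add_points.
Context {R : realType} (X : pmetricType R).
Implicit Types (w : config X) (s : seq X).

(** Points are added along a list, so that iterated integrals can introduce
    them one by one. *)
Definition add_points w s : config X := foldr (fun x v => add_point v x) w s.

Lemma points_add_points w s : points (add_points w s) = points w `|` [set` s].
Proof.
elim: s => [|x s /= ->].
  by rewrite /=; apply/seteqP; split=> [y wy|y [//|]//]; left.
rewrite -setUA; congr setU; apply/seteqP; split=> y /=; rewrite inE.
  by move=> [->|->]; rewrite ?eqxx ?orbT.
by move=> /predU1P[->|ys]; [right|left].
Qed.

Lemma eq_add_points w s t : s =i t -> add_points w s = add_points w t.
Proof.
move=> st; apply: config_ext; rewrite !points_add_points; congr setU.
by apply/seteqP; split=> x /=; rewrite st.
Qed.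

Lemma add_points_cat w s t :
  add_points w (s ++ t) = add_points (add_points w t) s.
Proof. exact: foldr_cat. Qed.

Lemma add_points_point w x s :
  add_points (add_point w x) s = add_points w (x :: s).
Proof.
rewrite -[add_point w x]/(add_points w [:: x]) -add_points_cat.
by apply: eq_add_points => y; rewrite mem_cat inE orbC inE.
Qed.

End add_points.

Section acyclicity.
Context {R : realType} (X Y : pmetricType R) (tau : config X -> X -> Y).
Hypothesis cyc : cyclic_condition tau.

(** Iterating [phi] inside the finite list must repeat a point, and the cyclic
    condition applies to the loop so obtained. *)
Lemma no_influence_cycle (w : config X) (phi : X -> X) (s : seq X) :
  s != [::] -> (forall x, x \in s -> phi x \in s) ->
  exists2 x, x \in s & tau (add_point w x) (phi x) = tau w (phi x).
Proof.
case: s => [//|x0 s0] _; set s := x0 :: s0 => phis.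
have it n : iter n phi x0 \in s.
  by elim: n => [|n IH]; [exact: mem_head|exact: phis].
(* One more iterate than there are points. *)
have : ~~ uniq [seq iter n phi x0 | n <- iota 0 (size s).+1].
  apply/negP => us; have := @uniq_leq_size _ _ s us.
  rewrite size_map size_iota ltnn => us'; suff : false by [].
  by apply: us' => _ /mapP[n _ ->].
move=> /(uniqPn x0)[i [j [ij]]]; rewrite size_map size_iota => js.
rewrite !(nth_map 0%N) ?size_iota ?(ltn_trans ij)// !nth_iota ?(ltn_trans ij)//.
rewrite !add0n => eij.
have [l tl] := @cyc _ w (fun l : 'I_(j - i) => iter (i + l) phi x0)
  ltac:(by rewrite subn_gt0).
exists (iter (i + l) phi x0) => //; move: tl.
suff -> : iter (i + ordS l) phi x0 = phi (iter (i + l) phi x0) by [].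
rewrite -iterS -addnS /=; have [lS|] := ltnP l.+1 (j - i).
  by rewrite modn_small.
move=> lS; have -> : l.+1 = (j - i)%N by apply/eqP; rewrite eqn_leq lS ltn_ord.
by rewrite modnn addn0 subnKC// ltnW.
Qed.

(** The combinatorial core. If every point of [s] were influenced by the others
    together, then removing [x] and arguing by induction over the base enlarged
    by [x] gives a point y with the same value after adding all of [s] as after
    adding [x] alone; since that value is not the one at [w], [x] influences y
    over [w]. So each point influences another, and a cycle appears. *)
Lemma uninfluenced_point (w : config X) (s : seq X) : s != [::] ->
  exists2 x, x \in s & tau (add_points w s) x = tau w x.
Proof.
move: {2}(size s) (leqnn (size s)) => n.
elim: n w s => [|n IH] w s; first by rewrite leqn0 size_eq0 => /eqP ->.
move=> sn s0; apply: contrapT => nosrc.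
have src x : x \in s -> tau (add_points w s) x <> tau w x.
  by move=> xs tx; apply: nosrc; exists x.
(* phi x is a point that x influences over w. *)
have /choice[phi phiP] : forall x, exists y, x \in s ->
    y \in s /\ tau (add_point w x) y <> tau w y.
  move=> x; have [xs|] := boolP (x \in s); last by exists x.
  have sE : add_points w s = add_points (add_point w x) (rem x s).
    rewrite add_points_point; apply: eq_add_points.
    exact/perm_mem/perm_to_rem.
  have [rs0|rs0] := eqVneq (rem x s) [::].
    by exists x => _; split => //; have := src x xs; rewrite sE rs0.
  have [|y yrs yE] := IH (add_point w x) (rem x s) _ rs0.
    by rewrite size_rem// -ltnS prednK// lt0n size_eq0.
  exists y => _; have ys : y \in s by exact: mem_rem yrs.
  by split => //; rewrite -yE -sE; exact: src.
have [|x xs] := @no_influence_cycle w phi s s0.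
  by move=> x /phiP[].
by have [_] := phiP x xs.
Qed.

End acyclicity.

(** * Iterated integrals over labelled points *)

(** Lists of a fixed length whose entries depend measurably on a parameter.
    Measurability of a function of a list of points is tested on these, which
    avoids any sigma-algebra on lists. *)
Inductive mlist (R : realType) (X : pmetricType R) d (Z : measurableType d) :
    (Z -> seq X) -> Prop :=
| mlist_nil : mlist (fun=> [::])
| mlist_cons (f : Z -> borel X) s : measurable_fun setT f -> mlist s ->
    mlist (fun z => (f z : X) :: s z).
Arguments mlist_nil {R X d Z}.

Section labelled_integrals.
Context {R : realType} (X : pmetricType R).
Variable sigma : {sigma_finite_measure set (borel X) -> \bar R}.
Local Open Scope ereal_scope.

Lemma mlist_comp d d' (Z : measurableType d) (Z' : measurableType d')
    (h : Z' -> Z) (s : Z -> seq X) :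
  measurable_fun setT h -> mlist s -> mlist (s \o h).
Proof.
move=> mh; elim=> [|f {}s mf _ IH]; first exact: mlist_nil.
by apply: (mlist_cons (f := f \o h)) IH; exact: measurableT_comp.
Qed.

Lemma mlist_cst d (Z : measurableType d) (s : seq X) :
  mlist (fun _ : Z => s).
Proof.
by elim: s => [|x s IH]; [exact: mlist_nil|exact: (mlist_cons (f := cst x))].
Qed.

Lemma mlist_cat d (Z : measurableType d) (s t : Z -> seq X) :
  mlist s -> mlist t -> mlist (fun z => s z ++ t z).
Proof.
by move=> + mt; elim=> [//|f {}s mf _ IH]; exact: (mlist_cons mf IH).
Qed.

(** The two lists hold the points carrying the first and the second label; in
    the application the labels say whether a point contributes its factor with
    all points added, or its factor over the base configuration. *)
Definition labelled_family d (Z : measurableType d) := Z -> seq X -> seq X ->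
    \bar R.

(** Nonnegativity and measurability along every measurable choice of the
    parameter and of the points: the least that Tonelli's theorem asks for, in a
    form that survives integration over one point. *)
Definition mfamily d (Z : measurableType d) (V : labelled_family Z) :=
  (forall z a b, 0 <= V z a b) /\
  forall d' (Z' : measurableType d') (h : Z' -> Z) (a b : Z' -> seq X),
    measurable_fun setT h -> mlist a -> mlist b ->
    measurable_fun setT (fun z => V (h z) (a z) (b z)).

Definition int_fst d (Z : measurableType d) (V : labelled_family Z) :
    labelled_family Z :=
  fun z a b => \int[sigma]_x V z ((x : X) :: a) b.

Definition int_snd d (Z : measurableType d) (V : labelled_family Z) :
    labelled_family Z :=
  fun z a b => \int[sigma]_x V z a ((x : X) :: b).

Definition family_add d (Z : measurableType d) (V V' : labelled_family Z) :
    labelled_family Z :=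
  fun z a b => V z a b + V' z a b.

Section operators.
Context d (Z : measurableType d).
Implicit Types V : labelled_family Z.

Lemma measurable_mfamily V z a b : mfamily V ->
  measurable_fun setT (fun x : borel X => V z ((x : X) :: a) b).
Proof.
move=> [_ mV]; apply: (mV _ _ (cst z)) => //; last exact: mlist_cst.
by apply: (mlist_cons (f := id)) => //; exact: mlist_cst.
Qed.

Lemma mfamily_comp d' (Z' : measurableType d') (k : Z' -> Z) V :
  measurable_fun setT k -> mfamily V -> mfamily (fun z => V (k z)).
Proof.
move=> mk [V0 mV]; split=> [//|d'' Z'' h a b mh ma mb].
by apply: (mV _ _ (k \o h)) => //; exact: measurableT_comp.
Qed.

Lemma mfamily_int_fst V : mfamily V -> mfamily (int_fst V).
Proof.
move=> [V0 mV]; split=> [z a b|d' Z' h a b mh ma mb].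
  by apply: integral_ge0 => x _; exact: V0.
apply: (measurable_fun_fubini_tonelli_F
  (fun p : Z' * borel X => V (h p.1) ((p.2 : X) :: a p.1) (b p.1))) => //.
apply: (mV _ _ (h \o fst)) => //; first exact: measurableT_comp.
- by apply: mlist_cons => //; exact: (mlist_comp measurable_fst).
- exact: (mlist_comp measurable_fst).
Qed.

Lemma mfamily_int_snd V : mfamily V -> mfamily (int_snd V).
Proof.
move=> [V0 mV]; split=> [z a b|d' Z' h a b mh ma mb].
  by apply: integral_ge0 => x _; exact: V0.
apply: (measurable_fun_fubini_tonelli_F
  (fun p : Z' * borel X => V (h p.1) (a p.1) ((p.2 : X) :: b p.1))) => //.
apply: (mV _ _ (h \o fst)) => //; first exact: measurableT_comp.
- exact: (mlist_comp measurable_fst).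
- by apply: mlist_cons => //; exact: (mlist_comp measurable_fst).
Qed.

Lemma mfamily_iter_int_fst n V : mfamily V -> mfamily (iter n (@int_fst _ Z) V).
Proof. by move=> gV; elim: n => //= n; exact: mfamily_int_fst. Qed.

Lemma mfamily_iter_int_snd n V : mfamily V -> mfamily (iter n (@int_snd _ Z) V).
Proof. by move=> gV; elim: n => //= n; exact: mfamily_int_snd. Qed.

Lemma int_fst_add V V' : mfamily V -> mfamily V' -> int_fst (family_add V V') =
    family_add (int_fst V) (int_fst V').
Proof.
move=> gV gV'; apply/funext => z; apply/funext => a; apply/funext => b.
rewrite /int_fst /family_add ge0_integralD//.
- by move=> x _; case: gV.
- exact: measurable_mfamily.
- by move=> x _; case: gV'.
- exact: measurable_mfamily.
Qed.

Lemma iter_int_fst_add n V V' : mfamily V -> mfamily V' ->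
  iter n (@int_fst _ Z) (family_add V V') = family_add
    (iter n (@int_fst _ Z) V) (iter n (@int_fst _ Z) V').
Proof.
move=> gV gV'; elim: n => //= n ->.
by rewrite int_fst_add//; exact: mfamily_iter_int_fst.
Qed.

Lemma int_fst_snd V : mfamily V -> int_fst (int_snd V) = int_snd (int_fst V).
Proof.
move=> [V0 mV]; apply/funext => z; apply/funext => a; apply/funext => b.
apply: (fubini_tonelli (m1 := sigma) (m2 := sigma)
  (fun p : borel X * borel X => V z ((p.1 : X) :: a) ((p.2 : X) :: b))) => //.
by apply: (mV _ _ (cst z)) => //; apply: mlist_cons => //; exact: mlist_cst.
Qed.

Lemma int_fst_iter_snd n V : mfamily V ->
  int_fst (iter n (@int_snd _ Z) V) = iter n (@int_snd _ Z) (int_fst V).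
Proof.
by move=> gV; elim: n => //= n IH; rewrite int_fst_snd ?IH//;
  exact: mfamily_iter_int_snd.
Qed.

End operators.

(** The sum, over all labellings of n integrated points, of the corresponding
    integrals, restricted to an even or to an odd number of second labels. The
    two halves of an alternating sum are kept apart so that all integrands stay
    nonnegative and no integrability is needed. *)
Fixpoint parity_int d (Z : measurableType d) (n : nat) (odd : bool)
    (V : labelled_family Z)
    : labelled_family Z :=
  match n with
  | 0 => if odd then fun _ _ _ => 0 else V
  | n'.+1 => family_add (parity_int n' odd (int_fst V))
    (parity_int n' (~~ odd) (int_snd V))
  end.

(** The same sum for a given list of points, without integration. *)
Fixpoint parity_sum (odd : bool) (s : seq X) (V : seq X -> seq X -> \bar R) :
    \bar R :=
  match s with
  | [::] => if odd then 0 else V [::] [::]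
  | x :: s' => parity_sum odd s' (fun a b => V (x :: a) b) +
               parity_sum (~~ odd) s' (fun a b => V a (x :: b))
  end.

Lemma mfamily_cons_fst d (Z : measurableType d) (f : Z -> borel X)
    (V : labelled_family Z) :
  measurable_fun setT f -> mfamily V ->
  mfamily ((fun z a b => V z ((f z : X) :: a) b) : labelled_family Z).
Proof.
move=> mf [V0 mV]; split=> [//|d' Z' h a b mh ma mb].
by apply: mV => //; apply: (mlist_cons (f := f \o h)) => //;
  exact: measurableT_comp.
Qed.

Lemma mfamily_cons_snd d (Z : measurableType d) (f : Z -> borel X)
    (V : labelled_family Z) :
  measurable_fun setT f -> mfamily V ->
  mfamily ((fun z a b => V z a ((f z : X) :: b)) : labelled_family Z).
Proof.
move=> mf [V0 mV]; split=> [//|d' Z' h a b mh ma mb].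
by apply: mV => //; apply: (mlist_cons (f := f \o h)) => //;
  exact: measurableT_comp.
Qed.

Lemma parity_sum_ge0 odd s (V : seq X -> seq X -> \bar R) :
  (forall a b, 0 <= V a b) -> 0 <= parity_sum odd s V.
Proof.
elim: s odd V => [|x s IH] odd V V0 /=; first by case: odd.
by rewrite adde_ge0// IH.
Qed.

Lemma measurable_parity_sum odd d (Z : measurableType d) (V : labelled_family Z)
    (s : Z -> seq X) :
  mfamily V -> mlist s -> measurable_fun setT
    (fun z => parity_sum odd (s z) (V z)).
Proof.
move=> + ms; elim: ms odd V => [|f {}s mf _ IH] odd V gV /=.
  case: odd => //; case: gV => _ mV.
  by apply: (mV _ _ id) => //; exact: mlist_nil.
apply: emeasurable_funD.
  exact: (IH _ (fun z a b => V z ((f z : X) :: a) b) (mfamily_cons_fst mf gV)).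
exact: (IH _ (fun z a b => V z a ((f z : X) :: b)) (mfamily_cons_snd mf gV)).
Qed.

Lemma mfamily_parity_sum odd d (Z : measurableType d) (V : labelled_family Z) :
    mfamily V ->
  mfamily ((fun z s _ => parity_sum odd s (V z)) : labelled_family Z).
Proof.
move=> gV; split=> [z a _|d' Z' h a b mh ma mb].
  by apply: parity_sum_ge0; case: gV.
by apply: (measurable_parity_sum _ (V := fun z => V (h z))) => //;
  exact: mfamily_comp.
Qed.

Lemma integral_parity_sum odd s (Q : labelled_family (borel X)) : mfamily Q ->
  \int[sigma]_x parity_sum odd s (Q x) = parity_sum odd s
    (fun a b => \int[sigma]_x Q x a b).
Proof.
elim: s odd Q => [|y s IH] odd Q gQ /=; first by case: odd; rewrite ?integral0.
have g1 := mfamily_cons_fst (measurable_cst (y : borel X)) gQ.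
have g2 := mfamily_cons_snd (measurable_cst (y : borel X)) gQ.
rewrite ge0_integralD//.
- congr (_ + _).
    exact: (IH _ (fun x a b => Q x (y :: a) b)).
  exact: (IH _ (fun x a b => Q x a (y :: b))).
- by move=> x _; apply: parity_sum_ge0 => *; case: gQ.
- by apply: (measurable_parity_sum _ (V := fun x a b => Q x (y :: a) b));
    [exact: g1|exact: mlist_cst].
- by move=> x _; apply: parity_sum_ge0 => *; case: gQ.
- by apply: (measurable_parity_sum _ (V := fun x a b => Q x a (y :: b)));
    [exact: g2|exact: mlist_cst].
Qed.

(** Summation over the labels and integration commute, which reduces an
    identity between the even and odd integrals to a pointwise one. *)
Lemma parity_intE d (Z : measurableType d) n odd (V : labelled_family Z) z :
    mfamily V ->
  parity_int n odd V z [::] [::] =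
  iter n (@int_fst _ Z) (fun z s _ => parity_sum odd s (V z)) z [::] [::].
Proof.
elim: n odd V => [|n IH] odd V gV; first by case: odd.
rewrite iterSr /= /family_add !IH;
  [|exact: mfamily_int_snd|exact: mfamily_int_fst].
have gp1 := mfamily_parity_sum odd (mfamily_int_fst gV);
  have gp2 := mfamily_parity_sum (~~ odd) (mfamily_int_snd gV).
rewrite -[LHS]/(family_add (iter n (@int_fst _ Z) _)
  (iter n (@int_fst _ Z) _) z [::] [::]).
rewrite -iter_int_fst_add//; congr (iter n _ _ z [::] [::]).
apply/funext => y; apply/funext => s; apply/funext => b;
  rewrite /int_fst /family_add /=.
have gid : measurable_fun setT (@id (borel X)) by [].
have gVy := mfamily_comp (measurable_cst y : measurable_fun (T := borel X) setT
  (cst y)) gV.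
have g1 := mfamily_cons_fst gid gVy; have g2 := mfamily_cons_snd gid gVy.
rewrite ge0_integralD//.
- congr (_ + _).
    by rewrite (integral_parity_sum _ _ g1).
  by rewrite (integral_parity_sum _ _ g2).
- by move=> x _; apply: parity_sum_ge0 => *; case: gV.
- by apply: (measurable_parity_sum _ g1); exact: mlist_cst.
- by move=> x _; apply: parity_sum_ge0 => *; case: gV.
- by apply: (measurable_parity_sum _ g2); exact: mlist_cst.
Qed.

Lemma eq_parity_sum odd s (V V' : seq X -> seq X -> \bar R) :
  (forall a b, perm_eq (a ++ b) s -> V a b = V' a b) -> parity_sum odd s V =
    parity_sum odd s V'.
Proof.
elim: s odd V V' => [|x s IH] odd V V' VV' /=.
  by case: odd => //; exact: VV'.
congr (_ + _); apply: IH => a b ab; apply: VV'.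
  by rewrite /= perm_cons.
by rewrite -cat1s perm_catCA perm_cons.
Qed.

(** The label of x picks one of the two terms of [F x - f x], and the parity
    keeps track of the sign. *)
Lemma parity_sum_prod (F f : X -> R) (k : R) s : exists p q : R,
  [/\ parity_sum false s (fun a b =>
    (k * (\prod_(x <- a) F x * \prod_(x <- b) f x))%:E)
        = p%:E,
      parity_sum true s (fun a b =>
        (k * (\prod_(x <- a) F x * \prod_(x <- b) f x))%:E)
        = q%:E &
      (p - q = k * \prod_(x <- s) (F x - f x))%R].
Proof.
elim: s k => [|x s IH] k /=.
  by exists k, 0%R; rewrite !big_nil !mulr1 subr0.
have [p1 [q1 [p1E q1E pq1]]] := IH (k * F x)%R.
have [p2 [q2 [p2E q2E pq2]]] := IH (k * f x)%R.
have e1 : (fun a b => (k * (\prod_(y <- x :: a) F y * \prod_(y <- b) f y))%:E)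
    = (fun a b => (k * F x * (\prod_(y <- a) F y * \prod_(y <- b) f y))%:E).
  by apply/funext => a; apply/funext => b; rewrite big_cons !mulrA.
have e2 : (fun a b => (k * (\prod_(y <- a) F y * \prod_(y <- x :: b) f y))%:E)
    = (fun a b => (k * f x * (\prod_(y <- a) F y * \prod_(y <- b) f y))%:E).
  by apply/funext => a; apply/funext => b; rewrite big_cons; congr EFin; ring.
exists (p1 + q2)%R, (q1 + p2)%R; rewrite e1 e2 p1E q1E p2E q2E !EFinD;
  split => //.
rewrite big_cons; rewrite mulrA mulrBr mulrBl -pq1 -pq2; ring.
Qed.

End labelled_integrals.

(** * Decoupling of acyclic families *)

Section decoupling.
Context {R : realType} (X : pmetricType R).
Variable sigma : {sigma_finite_measure set (borel X) -> \bar R}.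
Variables (g : config X -> X -> R) (c : R).
Hypothesis g_ge0 : forall w x, 0 <= g w x.
Hypothesis mg : measurable_fun setT
  (fun p : (Omega X * borel X)%type => g p.1 p.2).
Local Open Scope ereal_scope.
Hypothesis int_g : forall w, \int[sigma]_x (g w x)%:E = c%:E.
Hypothesis gE : forall w s, s != [::] ->
  exists2 x, x \in s & g (add_points w s) x = g w x.

Local Notation L1 := (@int_fst R X sigma _ (Omega X)).
Local Notation L2 := (@int_snd R X sigma _ (Omega X)).

(** A point with the first label is tested with all points added to [w], a
    point with the second label over [w] itself. *)
Definition mixed_prod : @labelled_family R X _ (Omega X) := fun w a b =>
  (\prod_(x <- a) g (add_points w (a ++ b)) x * \prod_(x <- b) g w x)%:E.

Lemma measurable_add_points d (Z : measurableType d) (W : Z -> Omega X)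
    (s : Z -> seq X) : measurable_fun setT W -> mlist s ->
  measurable_fun setT (fun z => add_points (W z) (s z) : Omega X).
Proof.
move=> mW; elim=> [//|f {}s mf _ IH].
exact: (measurableT_comp (@measurable_add_point R X)
  (measurable_fun_pair IH mf)).
Qed.

Lemma measurable_prod_g d (Z : measurableType d) (W : Z -> Omega X)
    (s : Z -> seq X) : measurable_fun setT W -> mlist s ->
  measurable_fun setT (fun z => \prod_(x <- s z) g (W z) x)%R.
Proof.
move=> mW; elim=> [|f {}s mf _ IH].
  rewrite (_ : (fun z => _) = cst 1%R)//.
  by apply/funext => z; rewrite big_nil.
rewrite (_ : (fun z => _) =
    (fun z => g (W z) (f z) * \prod_(x <- s z) g (W z) x)%R); last first.
  by apply/funext => z; rewrite big_cons.
apply: measurable_funM => //.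
exact: (measurableT_comp mg (measurable_fun_pair mW mf)).
Qed.

Lemma mfamily_mixed_prod : mfamily mixed_prod.
Proof.
split=> [w a b|d' Z' W a b mW ma mb].
  by rewrite lee_fin mulr_ge0// prodr_ge0.
apply/measurable_EFinP; apply: measurable_funM; last exact: measurable_prod_g.
by apply: measurable_prod_g => //; apply: measurable_add_points => //;
  exact: mlist_cat.
Qed.

Let c_ge0 : (0 <= c)%R.
Proof.
rewrite -lee_fin -(int_g point); apply: integral_ge0 => x _.
by rewrite lee_fin.
Qed.

Let mg1 w : measurable_fun setT (fun x : borel X => (g w x)%:E).
Proof.
apply/measurable_EFinP.
exact: (measurableT_comp mg (pair1_measurable (w : Omega X))).
Qed.

(** Points with the second label act on those with the first one only by
    enlarging the base configuration, apart from a factor that does not depend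
    on the integrated points. *)
Lemma iter_int_mixed_prod i w a b : iter i L1 mixed_prod w a b =
  iter i L1 mixed_prod (add_points w b) a [::] * (\prod_(x <- b) g w x)%:E.
Proof.
elim: i a => [|i IH] a /=.
  by rewrite /mixed_prod cats0 big_nil mulr1 add_points_cat EFinM.
have := mfamily_iter_int_fst sigma i mfamily_mixed_prod.
set T := iter i L1 mixed_prod in IH * => gT.
rewrite /L1 -ge0_integralZr//.
- by apply: eq_integral => x _; exact: IH.
- exact: (@measurable_mfamily _ _ _ _ T (add_points w b) a [::] gT).
- by move=> x _; case: gT.
- by rewrite lee_fin prodr_ge0.
Qed.

(** The second labels are integrated last, each of them giving [c] because the
    integral of [g v] does not depend on [v]. *)
Let mixed i j w b :
  (forall v, iter i L1 mixed_prod v [::] [::] = (c ^+ i)%:E) ->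
  iter j L2 (iter i L1 mixed_prod) w [::] b =
    (c ^+ (i + j) * \prod_(x <- b) g w x)%:E.
Proof.
move=> Ti; elim: j b => [|j IH] b /=.
  by rewrite iter_int_mixed_prod Ti addn0 EFinM.
set T := iter j L2 _ in IH *; rewrite /L2.
under eq_integral do rewrite IH big_cons mulrCA EFinM.
rewrite ge0_integralZr//; last 2 first.
- by move=> x _; rewrite lee_fin.
- by rewrite lee_fin mulr_ge0 ?exprn_ge0 ?prodr_ge0.
by rewrite int_g -EFinM addnS exprS mulrA.
Qed.

(** An uninfluenced point contributes a vanishing factor to the product of the
    differences. *)
Let parity_int_mixed_prod n w : (0 < n)%N ->
  parity_int sigma n false mixed_prod w [::] [::] =
    parity_int sigma n true mixed_prod w [::] [::].
Proof.
move=> n0; rewrite !parity_intE;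
  [|exact: mfamily_mixed_prod|exact: mfamily_mixed_prod].
have E (s : seq X) : (0 < size s)%N -> parity_sum false s (mixed_prod w) =
  parity_sum true s (mixed_prod w).
  move=> s0; have UE odd : parity_sum odd s (mixed_prod w) = parity_sum odd s
    (fun a b =>
      (1 * (\prod_(x <- a) g (add_points w s) x * \prod_(x <- b) g w x))%:E).
    apply: eq_parity_sum => a b ab; rewrite mul1r /mixed_prod.
    by rewrite (eq_add_points w (perm_mem ab)).
  have [p [q [pE qE pq]]] := parity_sum_prod (g (add_points w s)) (g w) 1 s.
  rewrite !UE pE qE; congr EFin; apply/eqP; rewrite -subr_eq0 pq mul1r.
  have [|x xs gx] := gE w (s := s); first by rewrite -size_eq0 -lt0n.
  by rewrite (big_rem x xs) gx/= subrr mul0r.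
suff H m a b : (0 < m + size a)%N ->
    iter m L1 (fun z s _ => parity_sum false s (mixed_prod z)) w a b =
    iter m L1 (fun z s _ => parity_sum true s (mixed_prod z)) w a b.
  by apply: H; rewrite addn0.
elim: m a => [|m IH] a ma /=; first exact: E.
by rewrite /L1; apply: eq_integral => x _; apply: IH; rewrite /= addnS.
Qed.

(** Under the cyclic condition, k integrated points behave as if none of them
    influenced another. By induction on k, each labelling with a second label
    gives c^k; as the even and the odd sums agree, so does the labelling
    without any. *)
Theorem iter_int_mixed_prod_exp k w : iter k L1 mixed_prod w [::] [::] =
    (c ^+ k)%:E.
Proof.
move: k w; apply: ltn_ind => -[_|k IH] w.
  by rewrite /= /mixed_prod !big_nil mulr1.
pose A i j : @labelled_family R X _ (Omega X) := iter j L2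
  (iter i L1 mixed_prod).
(* val n odd i j: n points still to be labelled, i with the first label and j
   with the second one. *)
pose val n odd i j := parity_int sigma n odd (A i j) w [::] [::].
have gA i : mfamily (iter i L1 mixed_prod)
  by exact/mfamily_iter_int_fst/mfamily_mixed_prod.
have valS n odd i j : val n.+1 odd i j = val n odd i.+1 j + val n
  (~~ odd) i j.+1.
  rewrite /val /= /family_add; congr (_ + _);
    congr (parity_int _ _ _ _ w [::] [::]).
  by rewrite /A int_fst_iter_snd//=; exact: gA.
have val0 i j : val 0%N false i j = A i j w [::] [::] by [].
have val1 i j : val 0%N true i j = 0 by [].
have valj i j : (0 < j)%N -> (i + j = k.+1)%N -> A i j w [::] [::] =
  (c ^+ k.+1)%:E.
  move=> j0 ij; rewrite /A mixed ?big_nil ?mulr1 ?ij// => v.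
  by apply: IH; rewrite -ij -[ltnLHS]addn0 ltn_add2l.
(* Once a second label is present, the even and the odd sums have the same
   number of terms, all equal to c^(k+1). *)
have step1 n i j : (0 < j)%N -> (i + j + n.+1 = k.+1)%N ->
    val n.+1 false i j = val n.+1 true i j /\ val n.+1 true i j < +oo.
  elim: n i j => [|n IHn] i j j0 ijn.
    rewrite !valS !val1 !val0 add0e adde0 !valj ?ltry//; lia.
  rewrite !(valS n.+1) -[~~ false]/true -[~~ true]/false.
  have [||-> f1] := IHn i.+1 j => //; first by lia.
  have [||-> f2] := IHn i j.+1 => //; first by lia.
  by split => //; exact: lte_add_pinfty.
(* Without a second label so far, one term of the even sum differs from
   c^(k+1): the one with first labels only. *)
have step2 n i : (i + n.+1 = k.+1)%N ->
    val n.+1 false i 0%N + (c ^+ k.+1)%:E =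
      A k.+1 0%N w [::] [::] + val n.+1 true i 0%N /\
    val n.+1 true i 0%N < +oo.
  elim: n i => [|n IHn] i ink.
    have -> : i = k by lia.
    by rewrite !valS !val1 !val0 add0e adde0 (valj k 1%N) ?ltry//; lia.
  rewrite !(valS n.+1) -[~~ false]/true -[~~ true]/false.
  have [|e1 f1] := IHn i.+1; first by lia.
  have [||-> f2] := step1 n i 1%N => //; first by lia.
  split; last exact: (lte_add_pinfty f1 f2).
  by rewrite addeAC e1 -addeA.
have [|e f] := step2 k 0%N; first by lia.
move: e; rewrite /val parity_int_mixed_prod// -/(val k.+1 true 0%N 0%N) addeC.
have v0 : 0 <= val k.+1 true 0%N 0%N.
  by rewrite /val parity_intE; [have [h _] := mfamily_iter_int_fst sigma k.+1
    (mfamily_parity_sum true mfamily_mixed_prod);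
      exact: h|exact: mfamily_mixed_prod].
have vf : val k.+1 true 0%N 0%N \is a fin_num by rewrite ge0_fin_numE.
by move=> e; rewrite -[LHS](addeK _ vf) -[in LHS]e addeK.
Qed.

End decoupling.

(** * Factorial moments and avoidance probability *)

Section falling_factorial.
Context {R : realType}.
Local Open Scope ereal_scope.

(** The falling factorial of an extended real; the truncation at 0 keeps every
    factor nonnegative and is harmless on integers. *)
Fixpoint falling (k : nat) (x : \bar R) : \bar R :=
  if k is k'.+1 then x * falling k' (maxe (x - 1) 0) else 1.

Lemma falling_ge0 k x : 0 <= x -> 0 <= falling k x.
Proof.
by elim: k x => //= k IH x x0; rewrite mule_ge0// IH// le_max lexx orbT.
Qed.

Lemma falling_nat k n : falling k n%:R%:E = (n ^_ k)%:R%:E.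
Proof.
elim: k n => [|k IH] n; first by rewrite ffactn0.
rewrite ffactnS /=; case: n => [|n]; first by rewrite mul0e mul0n.
rewrite -EFinB -natr1 addrK max_l ?lee_fin// natr1.
by rewrite IH natrM EFinM.
Qed.

Lemma falling_pinfty k : (0 < k)%N -> falling k +oo = +oo.
Proof.
case: k => // k _; elim: k => [|k IH]; first by rewrite /= mule1.
by rewrite [falling _ _]/= max_l ?leey// -/(falling k.+1 +oo) IH mulyy.
Qed.

Lemma measurable_falling k : measurable_fun setT (falling k).
Proof.
elim: k => [|k IH] //=; apply: emeasurable_funM => //.
apply: (measurableT_comp IH); apply: measurable_maxe => //.
by apply: (@emeasurable_funB _ _ _ setT id (cst 1)).
Qed.

End falling_factorial.

Section bonferroni.
Context {R : realType}.

Lemma alternating_binomial_sum n m :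
  \sum_(k < m.+1) (-1) ^+ k * 'C(n.+1, k)%:R = (-1) ^+ m * 'C(n, m)%:R :> R.
Proof.
elim: m => [|m IH]; first by rewrite big_ord1 !bin0.
by rewrite big_ord_recr/= IH binS natrD exprS; ring.
Qed.

(** Truncating the inclusion-exclusion formula leaves an error bounded by the
    first omitted term. *)
Lemma bonferroni n m :
  `|(n == 0%N)%:R - \sum_(k < m.+1) (-1) ^+ k * 'C(n, k)%:R| <=
    'C(n, m.+1)%:R :> R.
Proof.
case: n => [|n].
  rewrite big_ord_recl/= expr0 mul1r bin0 big1 ?addr0 ?subrr ?normr0//.
  by move=> i _; rewrite bin0n mulr0.
rewrite alternating_binomial_sum sub0r normrN normrM normrX normrN1 expr1n
  mul1r.
by rewrite normr_nat ler_nat binS leq_addl.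
Qed.

Lemma signed_sumE n (F : nat -> R) :
  \sum_(k < n) (-1) ^+ k * F k =
  \sum_(k < n | ~~ odd k) F k - \sum_(k < n | odd k) F k.
Proof.
rewrite (bigID (fun k : 'I_n => odd k)) /= addrC; congr (_ + _).
  by apply: eq_bigr => k /negbTE ok; rewrite -signr_odd ok mul1r.
by rewrite -sumrN; apply: eq_bigr => k ok; rewrite -signr_odd ok mulN1r.
Qed.

End bonferroni.

Section void_probability.
Context {R : realType} (X : pmetricType R).
Variables (sigma : {sigma_finite_measure set (borel X) -> \bar R})
  (P : probability (Omega X) R).
Hypothesis sX : sigma_compact X.
Hypothesis difs : diffuse sigma.
Hypothesis poiP : is_poisson_measure sigma P.
Variables (D : config X -> set X) (c : R).
Hypothesis mD : measurable [set p : (Omega X * borel X)%type | D p.1 p.2].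
Local Open Scope ereal_scope.
Hypothesis sigmaD : forall w, sigma (D w) = c%:E.
Hypothesis cycD : forall w s, s != [::] ->
  exists2 x, x \in s & (D (add_points w s) x <-> D w x).

Let g (w : config X) (x : X) : R := \1_(D w) x.
Local Notation L1 := (@int_fst R X sigma _ (Omega X)).

Let mDw (w : config X) : measurable (D w : set (borel X)).
Proof.
have := measurable_xsection (w : Omega X) mD; rewrite /xsection/=.
by congr measurable; apply/seteqP; split=> x /=; rewrite ?inE.
Qed.

Let g_ge0 w x : (0 <= g w x)%R.
Proof. by rewrite /g indicE. Qed.

Let mg : measurable_fun setT (fun p : (Omega X * borel X)%type => g p.1 p.2).
Proof.
rewrite (_ : (fun p => _) = \1_[set p : (Omega X * borel X)%type | D p.1 p.2]).
  exact: measurable_indic.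
by apply/funext => p; rewrite /g !indicE.
Qed.

Let int_g w : \int[sigma]_x (g w x)%:E = c%:E.
Proof. by rewrite /g integral_indic// setIT; exact: sigmaD. Qed.

Let gE w s : s != [::] ->
  exists2 x, x \in s & g (add_points w s) x = g w x.
Proof.
move=> /(cycD w)[x xs Dx]; exists x => //; rewrite /g !indicE.
by congr (_%:R); congr nat_of_bool; apply/idP/idP; rewrite !inE => /Dx.
Qed.

Let gU : mfamily (mixed_prod g) := mfamily_mixed_prod g_ge0 mg.

Definition hits (w : config X) (s : seq X) : \bar R :=
  config_measure w (D (add_points w s) : set (borel X)).

Let measurable_hits d (Z : measurableType d) (W : Z -> Omega X)
    (s : Z -> seq X) :
  measurable_fun setT W -> mlist s ->
  measurable_fun setT (fun z => hits (W z) (s z)).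
Proof.
move=> mW ms.
pose k (p : Z * borel X) : (Omega X * borel X)%type :=
  (add_points (W p.1) (s p.1), p.2).
have mk : measurable_fun setT k.
  apply: measurable_fun_pair => //.
  apply: (measurableT_comp (measurable_add_points mW ms)).
  exact: measurable_fst.
have mC : measurable (k @^-1` [set p | D p.1 p.2]).
  by rewrite -[X in measurable X]setTI; exact: mk.
have := measurable_config_xsection sX mW mC.
congr (measurable_fun _ _); apply/funext => z; rewrite /hits.
by congr config_measure; apply/seteqP; split=> x; rewrite /xsection/= inE.
Qed.

Let moment_fam k : @labelled_family R X _ (Omega X) :=
  fun w s _ => mixed_prod g w s [::] * falling k (hits w s).

Let mfamily_moment_fam k : mfamily (moment_fam k).
Proof.
split=> [w a b|d' Z W a b mW ma _].
  by apply: mule_ge0; [case: gU|exact: falling_ge0].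
apply: emeasurable_funM.
  by case: gU => _; apply => //; exact: mlist_nil.
apply: (measurableT_comp (measurable_falling k)).
exact: measurable_hits.
Qed.

(** A configuration is countable, so a diffuse measure does not charge it. This
    removes the case where the added point was already there. *)
Let sigma_points (w : config X) :
  measurable (points w : set (borel X)) /\ sigma (points w) = 0.
Proof.
have mw : measurable (points w : set (borel X)).
  apply: countable_measurable; last exact: points_countable.
  by move=> x; exact: set1_measurable_borel.
split => //; apply/negligibleP => //.
have /countable_injP[f injf] := points_countable w.
have /choice[h hP] : forall n : nat, exists x, forall y, points w y -> f y =
  n -> x = y.
  move=> n; have [[x [wx fx]]|nx] := pselect (exists x, points w x /\ f x = n).
    by exists x => y wy fy; apply: injf; rewrite ?inE// fx fy.
  by exists point => y wy fy; exfalso; apply: nx; exists y.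
apply: (@negligibleS _ _ _ sigma (\bigcup_n [set h n])).
  by move=> x wx; exists (f x) => //=; exact/esym/hP.
apply: negligible_bigcup => n.
exists [set h n]; split => //; first exact: set1_measurable_borel.
exact: difs.
Qed.

(** Picking a point of the configuration and adding it to the list lowers the
    number of remaining counted points by one. *)
Let moment_shift k w s x : ~ points w x ->
  mixed_prod g (add_point w x) s [::] *
    falling k (maxe (hits (add_point w x) s - 1) 0) *
    (g (add_points (add_point w x) s) x)%:E =
  moment_fam k w (x :: s) [::].
Proof.
move=> wx; rewrite /moment_fam /mixed_prod !cats0 big_nil !mulr1 big_cons.
rewrite /hits add_points_point; set w' := add_points w (x :: s).
rewrite config_measure_add_point// diracE /g indicE.
have -> : (x \in (D w' : set (borel X))) = (x \in D w') by [].
rewrite big_nil mulr1; set N := config_measure w _.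
have N0 : 0 <= N by exact: measure_ge0.
case: (x \in D w'); rewrite ?mulr1n ?mulr0n.
  by rewrite addeK// max_l// mule1 mul1r.
by rewrite mule0 mul0r mul0e.
Qed.

(** One application of Mecke's formula moves a point from the configuration to
    the list. *)
Let moment k s :
  \int[P]_w moment_fam k w s [::] = \int[P]_w iter k L1 (mixed_prod g) w s [::].
Proof.
elim: k s => [|k IH] s /=.
  by apply: eq_integral => w _; rewrite /moment_fam mule1.
pose h (p : (Omega X * borel X)%type) : \bar R := mixed_prod g p.1 s [::] *
  falling k (maxe (hits p.1 s - 1) 0) * (g (add_points p.1 s) p.2)%:E.
have h0 p : 0 <= h p.
  apply: mule_ge0; last by rewrite lee_fin.
  by apply: mule_ge0; [case: gU|apply: falling_ge0; rewrite le_max lexx orbT].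
have mns : measurable_fun setT (fun p : (Omega X * borel X)%type => hits p.1 s).
  by apply: measurable_hits; [exact: measurable_fst|exact: mlist_cst].
have mh : measurable_fun setT h.
  apply: emeasurable_funM.
    apply: emeasurable_funM.
      case: gU => _ mU; apply: mU;
        [exact: measurable_fst|exact: mlist_cst|exact: mlist_nil].
    apply: (measurableT_comp (measurable_falling k)).
    apply: measurable_maxe => //.
    exact: (@emeasurable_funB _ _ _ setT _ (cst 1)).
  apply/measurable_EFinP; apply: (measurableT_comp mg
    (measurable_fun_pair _ _)).
    by apply: measurable_add_points; [exact: measurable_fst|exact: mlist_cst].
  exact: measurable_snd.
transitivity (\int[P]_w \int[config_measure (w : config X)]_x h (w, x)).
  apply: eq_integral => w _; rewrite /h/=.
  rewrite ge0_integralZl//.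
  - rewrite integral_indic// setIT /moment_fam/= -/(hits w s).
    by rewrite -muleA [hits _ _ * _]muleC.
  - exact/measurable_EFinP/measurable_indic.
  - by move=> x _; rewrite lee_fin.
  - by apply: mule_ge0; [case: gU|apply: falling_ge0; rewrite le_max lexx orbT].
rewrite (mecke sX poiP h0 mh).
transitivity (\int[P]_w \int[sigma]_x moment_fam k w ((x : X) :: s) [::]).
  apply: eq_integral => w _; have [mw w0] := sigma_points w.
  apply: ge0_ae_eq_integral => //.
  - have mwx := pair1_measurable (w : Omega X) :
    measurable_fun [set: borel X] _.
    apply: (measurableT_comp mh (measurable_fun_pair _ _)) => //.
    exact: (measurableT_comp (@measurable_add_point R X) mwx).
  - exact: measurable_mfamily.
  - by move=> x _; case: (mfamily_moment_fam k).
  - exists (points w); split => // x /= nx; apply: contrapT => wx;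
    apply: nx => _.
    exact: moment_shift.
have mM : measurable_fun setT (fun p : (Omega X * borel X)%type =>
    moment_fam k p.1 ((p.2 : X) :: s) [::]).
  case: (mfamily_moment_fam k) => _ mM; apply: mM;
    [exact: measurable_fst| |exact: mlist_nil].
  by apply: mlist_cons; [exact: measurable_snd|exact: mlist_cst].
have mL : measurable_fun setT (fun p : (Omega X * borel X)%type =>
    iter k L1 (mixed_prod g) p.1 ((p.2 : X) :: s) [::]).
  case: (mfamily_iter_int_fst sigma k gU) => _ mL; apply: mL;
    [exact: measurable_fst| |exact: mlist_nil].
  by apply: mlist_cons; [exact: measurable_snd|exact: mlist_cst].
(* The induction hypothesis is an identity of expectations, so the expectation
   is moved inside and out again. *)
rewrite (fubini_tonelli (m1 := P) (m2 := sigma) _ mM); last first.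
  by move=> p; case: (mfamily_moment_fam k).
transitivity (\int[sigma]_x \int[P]_w iter k L1 (mixed_prod g) w
  ((x : X) :: s) [::]).
  by apply: eq_integral => x _; exact: (IH ((x : X) :: s)).
rewrite -(fubini_tonelli (m1 := P) (m2 := sigma) _ mL)//.
by move=> p; case: (mfamily_iter_int_fst sigma k gU).
Qed.

Definition hit_count (w : config X) : \bar R := config_measure w
    (D w : set (borel X)).

Lemma factorial_moment k : \int[P]_w falling k (hit_count w) = (c ^+ k)%:E.
Proof.
have := moment k [::]; rewrite /moment_fam.
under eq_integral do rewrite /mixed_prod !big_nil mulr1 mul1e.
move=> ->; under eq_integral do
  rewrite (iter_int_mixed_prod_exp g_ge0 mg int_g gE).
by rewrite integral_cst// [X in _ * X](probability_setT P) mule1.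
Qed.

Lemma measurable_hit_count : measurable_fun setT
    (hit_count : Omega X -> \bar R).
Proof.
have := @measurable_hits _ (Omega X) id (fun=> [::]).
by apply; [exact: measurable_id|exact: mlist_nil].
Qed.

Lemma mean_hit_count : \int[P]_w hit_count w = c%:E.
Proof.
rewrite -[RHS](factorial_moment 1); apply: eq_integral => w _.
by rewrite /= mule1.
Qed.

Let c_ge0 : (0 <= c)%R.
Proof. by rewrite -lee_fin -(sigmaD point). Qed.

Let term k (w : config X) : \bar R := (k`!%:R^-1)%:E * falling k (hit_count w).

Let term_ge0 k w : 0 <= term k w.
Proof.
by rewrite mule_ge0// ?falling_ge0 ?measure_ge0// lee_fin invr_ge0.
Qed.

Let measurable_term k : measurable_fun setT (term k : Omega X -> \bar R).
Proof.
apply: measurable_funeM; apply: measurableT_comp (measurable_falling k) _.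
exact: measurable_hit_count.
Qed.

Let integral_term k : \int[P]_w term k w = (exp_coeff c k)%:E.
Proof.
rewrite ge0_integralZl//.
- by rewrite factorial_moment -EFinM mulrC.
- apply: measurableT_comp (measurable_falling k) _; exact: measurable_hit_count.
- by move=> w _; rewrite falling_ge0// measure_ge0.
Qed.

Let empty : set (Omega X) := hit_count @^-1` [set 0].

Let measurable_empty : measurable empty.
Proof. by rewrite -[empty]setTI; apply: measurable_hit_count. Qed.

Let term_nat k w n : hit_count w = n%:R%:E -> term k w = ('C(n, k)%:R)%:E.
Proof.
move=> wn; rewrite /term wn falling_nat -EFinM -bin_ffact natrM mulrC mulfK//.
Qed.

Let term_pinfty k w : hit_count w = +oo -> (0 < k)%N -> term k w = +oo.
Proof.
move=> wy k0; rewrite /term wy falling_pinfty// gt0_muley// lte_fin invr_gt0.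
Qed.

(** When the count is infinite both inequalities hold because their right-hand
    sides contain the term of order m+1. *)
Let bonferroni_hit_count m w :
  (\1_empty w)%:E + \sum_(k < m.+1 | odd k) term k w <=
    \sum_(k < m.+1 | ~~ odd k) term k w + term m.+1 w /\
  \sum_(k < m.+1 | ~~ odd k) term k w <=
    (\1_empty w)%:E + \sum_(k < m.+1 | odd k) term k w + term m.+1 w.
Proof.
have sum_ge0 (Q : pred nat) : 0 <= \sum_(k < m.+1 | Q k) term k w.
  by apply: sume_ge0 => k _; exact: term_ge0.
have one_ge0 : 0 <= (\1_empty w)%:E :> \bar R by rewrite lee_fin.
have [wy|wfin] := eqVneq (hit_count w) +oo.
  have notNy (x : \bar R) : 0 <= x -> x != -oo by case: x.
  rewrite (term_pinfty wy)//; split; rewrite addey ?leey//; apply: notNy.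
    exact: (sum_ge0 (fun k => ~~ odd k)).
  by apply: adde_ge0 => //; exact: (sum_ge0 odd).
have /config_measure_nat[n wn] : config_measure w (D w : set (borel X)) < +oo.
  by rewrite ltey.
have wn' : hit_count w = n%:R%:E by [].
have -> : \1_empty w = (n == 0%N)%:R :> R.
  rewrite indicE; congr (_%:R); congr nat_of_bool.
  apply/idP/eqP; rewrite inE /empty /= wn'.
    by move=> [] /eqP; rewrite pnatr_eq0 => /eqP.
  by move=> ->.
have termE (Q : pred nat) : \sum_(k < m.+1 | Q k) term k w =
    (\sum_(k < m.+1 | Q k) 'C(n, k)%:R)%:E.
  by rewrite -sumEFin; apply: eq_bigr => k _; exact: term_nat.
rewrite (termE odd) (termE (fun k => ~~ odd k)) (term_nat _ wn').
rewrite -!EFinD !lee_fin.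
have := @bonferroni R n m.
rewrite (signed_sumE _ (fun k => 'C(n, k)%:R)) ler_norml => /andP[b1 b2].
by split; lra.
Qed.

Let void_estimate m :
  (`|fine (P empty) - \sum_(k < m.+1) exp_coeff (- c) k| <= exp_coeff c m.+1)%R.
Proof.
have Pfin := fin_num_measure P _ measurable_empty.
have isum (Q : pred nat) : \int[P]_w \sum_(k < m.+1 | Q k) term k w =
    (\sum_(k < m.+1 | Q k) exp_coeff c k)%:E.
  rewrite -sumEFin; under eq_integral do rewrite big_mkcond/=.
  rewrite ge0_integral_sum//.
  - rewrite [RHS]big_mkcond/=; apply: eq_bigr => k _.
    by case: (Q k); [exact: integral_term|exact: integral0].
  - by move=> k; case: (Q k).
  - by move=> k w _; case: (Q k).
have msum (Q : pred nat) : measurable_fun setT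
    (fun w : Omega X => \sum_(k < m.+1 | Q k) term k w).
  rewrite (_ : (fun w => _) = (fun w : Omega X =>
      \sum_(k < m.+1) if Q k then term k w else 0)); last first.
    by apply/funext => w; rewrite big_mkcond.
  by apply: emeasurable_sum => k; case: (Q k).
have sum_ge0 (Q : pred nat) w : 0 <= \sum_(k < m.+1 | Q k) term k w.
  by apply: sume_ge0 => k _; exact: term_ge0.
have ind_ge0 w : 0 <= (\1_empty w)%:E :> \bar R by rewrite lee_fin.
have mind : measurable_fun setT (fun w : Omega X => (\1_empty w)%:E : \bar R).
  exact/measurable_EFinP/measurable_indic.
have iind : \int[P]_w (\1_empty w)%:E = (fine (P empty))%:E.
  by rewrite integral_indic// setIT fineK.
have intD (f1 f2 : Omega X -> \bar R) : (forall w, 0 <= f1 w) ->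
    (forall w, 0 <= f2 w) -> measurable_fun setT f1 -> measurable_fun setT f2 ->
    \int[P]_w (f1 w + f2 w) = \int[P]_w f1 w + \int[P]_w f2 w.
  by move=> f10 f20 m1 m2; rewrite ge0_integralD.
pose even k := ~~ odd k.
have le1 : (fine (P empty))%:E + (\sum_(k < m.+1 | odd k) exp_coeff c k)%:E <=
    (\sum_(k < m.+1 | even k) exp_coeff c k)%:E + (exp_coeff c m.+1)%:E.
  rewrite -iind -(isum odd) -(isum even) -integral_term.
  rewrite -(intD _ _ ind_ge0 (sum_ge0 odd) mind (msum odd)).
  rewrite -(intD _ _ (sum_ge0 even) (term_ge0 _) (msum even)
    (measurable_term _)).
  apply: ge0_le_integral => //.
  - by move=> w _; apply: adde_ge0 => //; exact: (sum_ge0 odd).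
  - by apply: emeasurable_funD => //; exact: msum.
  - by apply: emeasurable_funD => //; exact: msum.
  - by move=> w _; have [] := bonferroni_hit_count m w.
have le2 : (\sum_(k < m.+1 | even k) exp_coeff c k)%:E <=
    (fine (P empty))%:E + (\sum_(k < m.+1 | odd k) exp_coeff c k)%:E +
    (exp_coeff c m.+1)%:E.
  have mo := emeasurable_funD mind (msum odd).
  have o0 w : 0 <= (\1_empty w)%:E + \sum_(k < m.+1 | odd k) term k w.
    by apply: adde_ge0 => //; exact: (sum_ge0 odd).
  rewrite -iind -(isum odd) -(isum even) -integral_term.
  rewrite -(intD _ _ ind_ge0 (sum_ge0 odd) mind (msum odd)).
  rewrite -(intD _ _ o0 (term_ge0 _) mo (measurable_term _)).
  apply: ge0_le_integral => //.
  - exact: emeasurable_funD.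
  - by move=> w _; have [] := bonferroni_hit_count m w.
have cE k : (exp_coeff (- c) k = (-1) ^+ k * exp_coeff c k)%R.
  by rewrite /exp_coeff /= [in LHS]exprNn -mulrA.
under eq_bigr do rewrite cE.
rewrite (signed_sumE _ (exp_coeff c)) ler_norml; move: le1 le2;
  rewrite -!EFinD !lee_fin.
by move=> l1 l2; apply/andP; split; lra.
Qed.

(** The remainder c^m/m! in Bonferroni's inequalities tends to 0. *)
Theorem void_probability : P [set w : Omega X | hit_count w = 0] =
    (expR (- c))%:E.
Proof.
have Pfin := fin_num_measure P _ measurable_empty.
rewrite -[LHS](fineK Pfin); congr EFin; apply/eqP.
rewrite -subr_eq0 -normr_le0.
have ps : (fun m => `|fine (P empty) - series (exp_coeff (- c)) m.+1|%R) @ \oo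
  -->
    `|fine (P empty) - expR (- c)|%R.
  apply: cvg_norm; apply: cvgB; first exact: cvg_cst.
  by rewrite (cvg_shiftS (series _)); exact: is_cvg_series_exp_coeff.
have c0 : (fun m => exp_coeff c m.+1) @ \oo --> (0%R : R).
  rewrite (cvg_shiftS (exp_coeff c)).
  exact/cvg_series_cvg_0/is_cvg_series_exp_coeff.
apply: (ler_cvg_to ps c0); apply: nearW => m.
by have := void_estimate m; rewrite /series/= big_mkord.
Qed.

End void_probability.

(** * Local finiteness of a Poisson intensity *)

Section locally_finite_measures.
Context {R : realType} (X : pmetricType R).
Local Open Scope ereal_scope.

Lemma ball_measurable_borel (x : X) (r : R) :
  measurable (ball x r : set (borel X)).
Proof. by apply: open_measurable_borel; exact: open_metric_ball. Qed.

Lemma thicken_finite_measure (nu : {measure set (borel X) -> \bar R})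
    (K : set X) : compact K ->
  (forall x, K x -> exists n : nat, nu (ball x n.+1%:R^-1) < +oo) ->
  exists m : nat, nu (thicken K m.+1%:R^-1) < +oo.
Proof.
move=> cK finK.
pose Q (U : set X) := measurable (U : set (borel X)) /\ nu U < +oo.
have [| | |V [oV KV [mV Vfin]]] := compact_union_cover (P := Q) cK.
- by split; [exact: measurable0|rewrite measure0 ltry].
- move=> A B [mA A1] [mB B1]; split; first exact: measurableU.
  by rewrite (le_lt_trans (measureU2 _ _ _))// lte_add_pinfty.
- move=> x /finK[n xn]; exists (ball x n.+1%:R^-1).
    split; first exact: open_metric_ball.
    by apply: ballxx; exact: inv_succ_gt0.
  by split => //; exact: ball_measurable_borel.
have [m mV'] := thicken_compact_sub cK oV KV; exists m.
apply: le_lt_trans Vfin; apply: le_measure => //; rewrite ?inE//.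
by apply: open_measurable_borel; exact: open_thicken.
Qed.

(** Intersect an exhausting sequence of compact sets with the points at distance
    at least 1/(n+1) from the complement. *)
Lemma open_compact_exhaust (U : set X) : sigma_compact X -> open U ->
  exists C : nat -> set X,
    [/\ forall n, compact (C n), nondecreasing_seq C & \bigcup_n C n = U].
Proof.
move=> /sigma_compact_nondecreasing[K [cK ndK UK]] oU.
exists (fun n => K n `\` thicken (~` U) n.+1%:R^-1); split.
- by move=> n; apply: compact_setD_open => //; exact: open_thicken.
- move=> m n mn; apply/subsetPset => x [Kx nx]; split.
    by move: x Kx {nx}; exact/subsetPset/ndK.
  apply: contra_not nx => -[y Uy yx]; exists y => //.
  by apply: le_ball yx; rewrite lef_pV2 ?posrE// ler_nat ltnS.
- apply/seteqP; split=> [x [n _ [_ nx]]|x Ux].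
    by apply: contrapT => nUx; apply: nx; apply: sub_thicken => //;
      exact: inv_succ_gt0.
  have : (\bigcup_n K n) x by rewrite UK.
  move=> [n _ Kx].
  move: (oU); rewrite openE => /(_ x Ux);
    rewrite /interior => /nbhs_ballP[e /= e0 xe].
  have [k ke] := small_inv e0.
  exists (maxn n k) => //; split.
    by move: x Kx {Ux xe}; apply/subsetPset/ndK; exact: leq_maxl.
  move=> [y nUy yx]; apply: nUy; apply: xe; apply/ball_sym; apply: le_ball yx.
  by rewrite (le_trans _ (ltW ke))// lef_pV2 ?posrE// ler_nat ltnS leq_maxr.
Qed.

Variables (sigma : {sigma_finite_measure set (borel X) -> \bar R})
  (P : probability (Omega X) R).
Hypothesis sX : sigma_compact X.
Hypothesis difs : diffuse sigma.
Hypothesis poiP : is_poisson_measure sigma P.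

Lemma measurable_void_event (A : set (borel X)) : measurable A ->
  measurable (void_event A : set (Omega X)).
Proof.
move=> mA; rewrite -[X in measurable X]setTI.
exact: (measurable_config_measure sX mA measurableT (emeasurable_set1 0)).
Qed.

(** Compact subsets of [U] have arbitrarily large intensity s, and each of them
    is avoided with probability exp(-s). *)
Let void_event_open_null (U : set X) : open U -> sigma U = +oo ->
  P (void_event U) = 0.
Proof.
move=> oU sU; have [C [cC ndC UC]] := open_compact_exhaust sX oU.
have mC n := compact_measurable_borel (cC n).
have mU := open_measurable_borel oU.
have Pfin := fin_num_measure P _ (measurable_void_event mU).
have : sigma (C n) @[n --> \oo] --> +oo.
  rewrite -sU -UC; apply: nondecreasing_cvg_mu => //.
  exact: bigcupT_measurable.
move=> /cvgeyPge/(_ (fine (P (void_event U)))^-1%R)[N _ /(_ N (leqnn N)) /= CN].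
have le : (fine (P (void_event U)) <= expR (- fine (sigma (C N))))%R.
  rewrite -lee_fin fineK// -(poisson_void_event poiP)//.
  apply: le_measure; rewrite ?inE; [exact: measurable_void_event..|].
  by rewrite -UC void_event_bigcup; exact: bigcap_inf.
move: CN; rewrite -(fineK (poisson_intensity_fin_num poiP (cC N))) lee_fin =>
  CN.
rewrite -[LHS](fineK Pfin); congr EFin; apply/eqP; apply: contraPT CN => p0.
have {}p0 : (0 < fine (P (void_event U)))%R.
  by rewrite lt_neqAle eq_sym p0 fine_ge0.
move: le; set p := fine _ in p0 *; set s := fine _ => le; apply/negP.
rewrite -ltNge; have := expR_ge1Dx s; rewrite expRN in le.
have es := expR_gt0 s.
have : (expR s <= p^-1)%R by rewrite -[expR s]invrK lef_pV2 ?posrE ?invr_gt0.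
lra.
Qed.

(** Each configuration leaves a punctured ball around x empty. If all balls had
    infinite intensity, this would be a countable union of null events, since a
    punctured ball is open and, the intensity being diffuse, as heavy as the
    ball. *)
Lemma poisson_intensity_locally_finite (x : X) :
  exists n : nat, sigma (ball x n.+1%:R^-1) < +oo.
Proof.
apply: contrapT => ninf.
pose B n := ball x (n.+1%:R^-1 : R) `\ x.
have oB n : open (B n).
  rewrite /B setDE; apply: openI; first exact: open_metric_ball.
  apply: closed_openC.
  by apply: compact_closed; [exact:
    (@metric_hausdorff R X)|exact: compact_set1].
have sB n : sigma (B n) = +oo.
  apply/eqP; apply: contrapT => /negP; rewrite -ltey => Bn; apply: ninf;
    exists n.
  have -> : ball x (n.+1%:R^-1 : R) = [set x] `|` B n.
    by rewrite /B setDUK// => _ ->; apply: ballxx; exact: inv_succ_gt0.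
  have mx := set1_measurable_borel x.
  have mB := open_measurable_borel (oB n).
  rewrite (le_lt_trans (measureU2 _ mx mB))// lte_add_pinfty//.
  by rewrite [X in X < _](difs x) ltry.
have : P setT = 0.
  apply: measure_negligible; first exact: measurableT.
  apply: (@negligibleS _ _ _ P (\bigcup_n void_event (B n))); last first.
    apply: negligible_bigcup => n; apply/negligibleP.
      by apply: measurable_void_event; exact: open_measurable_borel.
    exact: void_event_open_null.
  move=> w _; have [U xU fU] := points_locally_finite w x.
  have [m mP] : exists m : nat, forall y z : X,
      ((points w `&` U) `|` [set x]) y -> ((points w `&` U) `|` [set x]) z ->
      ball y (m.+1%:R^-1 : R) z -> y = z.
    by apply: finite_set_separated; rewrite finite_setU.
  move: xU => /nbhs_ballP[e /= e0 xe]; have [k ke] := small_inv e0.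
  exists (maxn m k) => //; apply/config_measure_eq0; apply/seteqP;
    split => // y.
  move=> [wy [xy yx]]; apply: yx; apply/esym; apply: mP; first by right.
    left; split => //; apply: xe; apply: le_ball xy.
    by rewrite (le_trans _ (ltW ke))// lef_pV2 ?posrE// ler_nat ltnS leq_maxr.
  by apply: le_ball xy; rewrite lef_pV2 ?posrE// ler_nat ltnS leq_maxl.
by rewrite probability_setT => /eqP; rewrite onee_eq0.
Qed.

Lemma small_ball_measure (x : X) (e : R) : (0 < e)%R ->
  exists n : nat, sigma (ball x n.+1%:R^-1) < e%:E.
Proof.
move=> e0; have [n0 fin0] := poisson_intensity_locally_finite x.
pose F n : set X := ball x ((n0 + n).+1%:R^-1 : R).
have mF n : measurable (F n : set (borel X)) by exact: ball_measurable_borel.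
have ndF : nonincreasing_seq F.
  move=> m n mn; apply/subsetPset; apply: le_ball.
  by rewrite lef_pV2 ?posrE// ler_nat ltnS leq_add2l.
have capF : \bigcap_n F n = [set x].
  apply/seteqP; split=> [y Fy|_ -> n _]; last by apply: ballxx;
    exact: inv_succ_gt0.
  apply: contrapT => /eqP; rewrite eq_sym -mdist_gt0 => /small_inv[k kxy].
  have := Fy k I; rewrite /F ballEmdist/= => lt1.
  have : ((n0 + k).+1%:R^-1 <= k.+1%:R^-1 :> R)%R.
    by rewrite lef_pV2 ?posrE// ler_nat ltnS leq_addl.
  move=> le2; have := lt_trans (lt_le_trans lt1 le2) kxy.
  by rewrite ltxx.
have : sigma (F n) @[n --> \oo] --> sigma (\bigcap_n F n).
  apply: nonincreasing_cvg_mu => //; first by rewrite /F addn0.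
  by rewrite capF; exact: set1_measurable_borel.
rewrite capF [X in _ --> X](difs x) =>
  /fine_cvgP[[N1 _ fN1] /cvgr_lt/(_ e e0)[N2 _ lN2]].
exists (n0 + maxn N1 N2)%N.
have := lN2 _ (leq_maxr N1 N2); have := fN1 _ (leq_maxl N1 N2) => /= fF.
by rewrite /= -lte_fin fineK.
Qed.

End locally_finite_measures.

(** * The image process *)

Section transport.
Context {R : realType} (X Y : pmetricType R).
Variables (sigma : {sigma_finite_measure set (borel X) -> \bar R})
  (mu : {sigma_finite_measure set (borel Y) -> \bar R})
  (pi_sigma : probability (Omega X) R) (pi_mu : probability (Omega Y) R)
  (tau : config X -> X -> Y).
Hypotheses (sX : sigma_compact X) (sY : sigma_compact Y)
  (difs : diffuse sigma) (difm : diffuse mu)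
  (poi_sigma : is_poisson_measure sigma pi_sigma)
  (poi_mu : is_poisson_measure mu pi_mu)
  (mtau : measurable_fun setT
    (fun p : (Omega X * borel X)%type => tau p.1 p.2 : borel Y))
  (tau_maps : forall w : config X,
    maps_measure (tau w : borel X -> borel Y) sigma mu)
  (cyc : cyclic_condition tau).
Local Open Scope ereal_scope.

Definition image_count (w : config X) (B : set (borel Y)) : \bar R :=
  config_measure w (tau w @^-1` B : set (borel X)).

Let mtauB (B : set (borel Y)) : measurable B ->
  measurable [set p : (Omega X * borel X)%type | (tau p.1 @^-1` B) p.2].
Proof. by move=> mB; have := mtau measurableT mB; rewrite setTI. Qed.

Let muE (w : config X) (B : set (borel Y)) : measurable B ->
  sigma (tau w @^-1` B) = mu B.
Proof. by move=> mB; have [_ /(_ B mB)] := tau_maps w. Qed.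

Let cycB (B : set (borel Y)) w s : s != [::] ->
  exists2 x, x \in s & ((tau (add_points w s) @^-1` B) x <-> (tau w @^-1` B) x).
Proof.
by move=> /(uninfluenced_point cyc w)[x xs tx]; exists x => //; rewrite /= tx.
Qed.

Lemma measurable_image_count (B : set (borel Y)) : measurable B ->
  measurable_fun setT (fun w : Omega X => image_count (w : config X) B).
Proof.
by move=> mB; exact: (measurable_hit_count sX (mtauB mB)).
Qed.

Lemma image_count_void (B : set (borel Y)) : measurable B -> mu B < +oo ->
  pi_sigma [set w : Omega X | image_count w B = 0] = (expR (- fine (mu B)))%:E.
Proof.
move=> mB muB; have fB : mu B \is a fin_num by rewrite ge0_fin_numE.
apply: (void_probability sX difs poi_sigma (mtauB mB)).
  by move=> w; rewrite muE// fineK.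
by move=> w s; exact: cycB.
Qed.

Lemma image_count_mean (B : set (borel Y)) : measurable B -> mu B < +oo ->
  \int[pi_sigma]_w image_count w B = mu B.
Proof.
move=> mB muB; have fB : mu B \is a fin_num by rewrite ge0_fin_numE.
rewrite -[RHS]fineK//.
apply: (mean_hit_count sX difs poi_sigma (mtauB mB)).
  by move=> w; rewrite muE// fineK.
by move=> w s; exact: cycB.
Qed.

Lemma image_count_pinfty_null (B : set (borel Y)) :
  measurable B -> mu B < +oo ->
  pi_sigma.-negligible [set w : Omega X | ~ (image_count w B < +oo)].
Proof.
move=> mB muB; have mN := measurable_image_count mB.
have iN : pi_sigma.-integrable setT (fun w : Omega X => image_count w B).
  apply/integrableP; split => //.
  under eq_integral do rewrite gee0_abs ?measure_ge0//.
  by rewrite image_count_mean.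
have [N [mN' N0 NP]] := integrable_ae measurableT iN.
exists N; split => // w /= ninf; apply: NP => /= fin; apply: ninf.
by rewrite ltey_eq fin.
Qed.

(** The indicators of N >= 1 and N >= 2 add up to at most N, whence the bound
    E[N] - P(N >= 1) = c - 1 + exp(-c). *)
Lemma image_count_multiple (B : set (borel Y)) : measurable B -> mu B < +oo ->
  pi_sigma [set w : Omega X | ~ (image_count w B <= 1)] <= mu B * mu B.
Proof.
move=> mB muB; have fB : mu B \is a fin_num by rewrite ge0_fin_numE.
have mN := measurable_image_count mB.
set E2 := [set w | _]; pose E0 : set (Omega X) := [set w | image_count w B = 0].
have mE0 : measurable E0.
  have := mN measurableT _ (emeasurable_set1 0); rewrite setTI.
  by congr measurable.
have mE2 : measurable E2.
  have := emeasurable_fun_o_infty measurableT mN 1; rewrite setTI => m1.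
  rewrite (_ : E2 = [set w : Omega X | 1 < image_count w B])//.
  by apply/seteqP; split=> w /=; rewrite ltNge => /negP.
have le : pi_sigma (~` E0) + pi_sigma E2 <= mu B.
  rewrite -(image_count_mean mB muB).
  have -> : pi_sigma (~` E0) = \int[pi_sigma]_w (\1_(~` E0) w)%:E.
    by rewrite integral_indic ?setIT//; exact: measurableC.
  have -> : pi_sigma E2 = \int[pi_sigma]_w (\1_E2 w)%:E.
    by rewrite integral_indic ?setIT.
  rewrite -ge0_integralD//; last 2 first.
  - by apply/measurable_EFinP/measurable_indic; exact: measurableC.
  - exact/measurable_EFinP/measurable_indic.
  apply: ge0_le_integral => //.
  - by move=> w _; rewrite lee_fin addr_ge0.
  - by apply: emeasurable_funD; apply/measurable_EFinP/measurable_indic => //;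
      exact: measurableC.
  move=> w _; rewrite !indicE in_setC.
  have [->|Nfin] := eqVneq (image_count w B) +oo; first by rewrite leey.
  have [n nE] : exists n : nat, image_count w B = n%:R%:E.
    by apply: config_measure_nat; rewrite ltey.
  have -> : (w \in E0) = (n == 0%N).
    apply/idP/eqP; rewrite inE /E0/= nE; last by move=> ->.
    by move=> [] /eqP; rewrite pnatr_eq0 => /eqP.
  have -> : (w \in E2) = (1 < n)%N.
    apply/idP/idP; rewrite inE /E2/= nE lee_fin (ler_nat _ n 1) ltnNge.
      by move/negP.
    by move=> /negP.
  rewrite nE -EFinD lee_fin -natrD ler_nat.
  by case: n {nE} => [|[|n]].
move: le; rewrite probability_setC// -/E0.
rewrite (image_count_void mB muB) -(fineK fB).
have fE2 := fin_num_measure pi_sigma _ mE2.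
rewrite -(fineK fE2) -EFinB -EFinD -EFinM !lee_fin.
set c := fine (mu B); set p := fine _ => le.
have c0 : (0 <= c)%R by rewrite fine_ge0.
suff : (expR (- c) <= 1 - c + c * c)%R by lra.
(* exp(-c) <= 1/(1+c) <= 1 - c + c^2, as (1 + c)(1 - c + c^2) = 1 + c^3. *)
have d0 : (0 < 1 - c + c * c)%R.
  have := sqr_ge0 (c - 1 / 2); rewrite expr2; lra.
rewrite expRN -[leRHS]invrK lef_pV2 ?posrE ?expR_gt0 ?invr_gt0//.
apply: le_trans (expR_ge1Dx c); rewrite -[leLHS]mul1r ler_pdivrMr//.
have c3 : (0 <= c * c * c)%R by rewrite !mulr_ge0.
lra.
Qed.

(** Balls around one point shrink to a null set; compactness makes their size
    uniform. *)
Lemma small_balls (K : set Y) (e : R) : compact K -> (0 < e)%R ->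
  exists m : nat, forall y, K y -> mu (ball y m.+1%:R^-1) < e%:E.
Proof.
move=> /compact_near_coveringP cK e0.
have := cK _ \oo (fun m y => mu (ball y (m.+1%:R^-1 : R)) < e%:E) _ _.
case; last first.
  by move=> N _ /(_ N (leqnn _)) KN; exists N.
move=> y Ky; have [n yn] := small_ball_measure sY difm poi_mu y e0.
have n2 : (0 < n.+1%:R^-1 / 2 :> R)%R by rewrite divr_gt0.
have [N Nn] := small_inv n2.
exists (ball y (n.+1%:R^-1 / 2 : R), [set m | (N <= m)%N]) => /=.
  by split; [exact: nbhsx_ballx|exists N].
move=> [z m] [/= yz Nm]; apply: le_lt_trans yn; apply: le_measure; rewrite ?inE.
- exact: ball_measurable_borel.
- exact: ball_measurable_borel.
- move=> x zx; rewrite [n.+1%:R^-1%R]splitr; apply: ball_triangle yz _.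
  apply: le_ball zx; rewrite (le_trans _ (ltW Nn))//.
  by rewrite lef_pV2 ?posrE// ler_nat ltnS.
Qed.

Section partitions.
Variables (K : nat -> set Y) (Pc : nat -> nat -> nat -> set Y).
Hypotheses (cK : forall n, compact (K n)) (UK : \bigcup_n K n = setT).
Hypothesis PcP : forall n m, [/\ forall j, measurable
  (Pc n m j : set (borel Y)),
  trivIset setT (Pc n m), \bigcup_j Pc n m j = K n &
  forall j x y, Pc n m j x -> Pc n m j y -> ball x (m.+1%:R^-1 : R) y].

(** The image has finitely many points near each [K n], and none of them is
    multiple. Countably many conditions suffice: a neighbourhood of [K n] may be
    taken among its thickenings, and points of [K n] are separated by a fine
    partition. *)
Definition proper_image (w : config X) : Prop :=
  (forall n, exists m, image_count w (thicken (K n) m.+1%:R^-1) < +oo) /\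
  (forall n, exists m, forall j, image_count w (Pc n m j) <= 1).

Let mPc n m j : measurable (Pc n m j : set (borel Y)).
Proof. by have [] := PcP n m. Qed.

Let mthick n (r : R) : measurable (thicken (K n) r : set (borel Y)).
Proof. by apply: open_measurable_borel; exact: open_thicken. Qed.

Let PcK n m j : Pc n m j `<=` K n.
Proof. by have [_ _ <- _] := PcP n m => x Px; exists j. Qed.

Lemma image_config_proper w eta :
  is_image_config (tau w) w eta -> proper_image w.
Proof.
move=> img; have countE (B : set (borel Y)) : measurable B ->
    image_count w B = config_measure eta B.
  by move=> mB; rewrite img// /image_count /config_measure; apply: eq_esum.
split=> n.
  have [|m fm] := thicken_finite_measure (nu := config_measure eta) (@cK n).
    move=> y _; have [U /nbhs_ballP[e /= e0 yU] fU] :=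
      points_locally_finite eta y.
    have [m me] := small_inv e0; exists m; apply: config_measure_finite.
    apply: sub_finite_set fU; apply: setIS => z yz; apply: yU.
    by apply: le_ball yz; exact: ltW.
  by exists m; rewrite countE.
have [m mP] := config_measure_le1_fine eta (@cK n).
exists m => j; rewrite countE//; apply: mP; first exact: PcK.
by have [_ _ _] := PcP n m; exact.
Qed.

Lemma proper_image_config w : proper_image w ->
  exists eta, is_image_config (tau w) w eta.
Proof.
move=> [lf simple].
have inK y : exists n, K n y.
  by have : (\bigcup_n K n) y by [rewrite UK]; move=> [n _ Kn]; exists n.
have inj : {in points w &, injective (tau w)}.
  move=> x x'; rewrite !inE => wx wx' xx'; apply: contrapT => nxx'.
  have [n Kn] := inK (tau w x); have [m mP] := simple n.
  have [_ _ U _] := PcP n m; have : (\bigcup_j Pc n m j) (tau w x) by rewrite U.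
  move=> [j _ jx]; have := mP j; rewrite leNgt => /negP; apply.
  apply: (@lt_le_trans _ _ 2%:E); first by rewrite lte_fin ltr1n.
  by apply: (@config_measure_ge2 _ _ w _ x x') => //=; rewrite -xx'.
have ceta : countable (tau w @` points w).
  exact: sub_countable (card_image_le _ _) (points_countable w).
have leta : locally_finite (tau w @` points w).
  move=> y; have [n Kn] := inK y; have [m fm] := lf n.
  exists (thicken (K n) m.+1%:R^-1).
    apply: open_nbhs_nbhs; split; first exact: open_thicken.
    by apply: sub_thicken => //; exact: inv_succ_gt0.
  have := finite_image (tau w) (config_measure_infinite fm).
  by apply: sub_finite_set => _ [[x wx <-] Tx]; exists x.
exists (Config ceta leta) => B mB; rewrite /config_measure /=.
by rewrite esum_image.
Qed.

Lemma measurable_proper_image :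
  measurable [set w : Omega X | proper_image w].
Proof.
have mlt B : measurable B ->
    measurable [set w : Omega X | image_count w B < +oo].
  move=> mB; rewrite -[X in measurable X]setTI.
  exact: (emeasurable_fun_infty_o measurableT (measurable_image_count mB)).
have mle B : measurable B ->
    measurable [set w : Omega X | image_count w B <= 1].
  move=> mB; rewrite -[X in measurable X]setTI.
  exact: (emeasurable_fun_infty_c measurableT (measurable_image_count mB)).
rewrite (_ : [set w | _] = (\bigcap_n \bigcup_m
    [set w : Omega X | image_count w (thicken (K n) m.+1%:R^-1) < +oo]) `&`
  (\bigcap_n \bigcup_m \bigcap_j
    [set w : Omega X | image_count w (Pc n m j) <= 1])).
  apply: measurableI; apply: bigcapT_measurable => n;
    apply: bigcupT_measurable => m; first exact: mlt.
  by apply: bigcapT_measurable => j; exact: mle.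
apply/seteqP; split=> w [lf simple]; split.
- by move=> n _; have [m] := lf n; exists m.
- by move=> n _; have [m mP] := simple n; exists m => // j _; exact: mP.
- by move=> n; have [m _] := lf n I; exists m.
- by move=> n; have [m _ mP] := simple n I; exists m => j; exact: mP.
Qed.

(** On [K n], a multiple point makes some piece of every partition contain two
    points. The probability of that is at most the sum of the squared masses of
    the pieces, hence at most the largest mass times that of [K n]. *)
Lemma improper_image_null :
  pi_sigma.-negligible [set w : Omega X | ~ proper_image w].
Proof.
apply: (@negligibleS _ _ _ pi_sigma
  ((\bigcup_n [set w : Omega X | forall m : nat,
     ~ (image_count w (thicken (K n) m.+1%:R^-1) < +oo)]) `|`
   (\bigcup_n [set w : Omega X | forall m : nat, exists j : nat,
     ~ (image_count w (Pc n m j) <= 1)]))).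
  move=> w nw; apply: contrapT => /not_orP[n1 n2]; apply: nw; split=> n.
    apply: contrapT => nm; apply: n1; exists n => // m h.
    by apply: nm; exists m.
  apply: contrapT => nm; apply: n2; exists n => // m.
  apply: contrapT => nj; apply: nm; exists m => j; apply: contrapT => h.
  by apply: nj; exists j.
apply: negligibleU; apply: negligible_bigcup => n.
  have [|m fm] := thicken_finite_measure (nu := mu) (@cK n).
    by move=> y _; exact: (poisson_intensity_locally_finite sY difm poi_mu).
  apply: negligibleS (image_count_pinfty_null (mthick n _) fm).
  by move=> w /(_ m).
have fK : mu (K n) \is a fin_num by exact: poisson_intensity_fin_num poi_mu _
  (@cK n).
have fPc m j : mu (Pc n m j) < +oo.
  apply: (@le_lt_trans _ _ (mu (K n))); last by rewrite ltey_eq fK.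
  apply: le_measure; rewrite ?inE; [exact: mPc| |exact: PcK].
  exact: compact_measurable_borel.
have m2 B : measurable B ->
    measurable [set w : Omega X | ~ (image_count w B <= 1)].
  move=> mB; apply: measurableC; rewrite -[X in measurable X]setTI.
  exact: (emeasurable_fun_infty_c measurableT (measurable_image_count mB)).
pose E m := \bigcup_j [set w : Omega X | ~ (image_count w (Pc n m j) <= 1)].
have mE m : measurable (E m) by apply: bigcupT_measurable => j; exact: m2.
have PE (e : R) : (0 < e)%R -> exists m, pi_sigma (E m) <= e%:E * mu (K n).
  move=> e0; have [m mP] := small_balls (@cK n) e0; exists m.
  have [_ tP UP diamP] := PcP n m.
  have mu_le j : mu (Pc n m j) <= e%:E.
    have [->|/set0P[y Py]] := eqVneq (Pc n m j) set0.
      by rewrite measure0 lee_fin ltW.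
    apply: le_trans (ltW (mP y (PcK Py))); apply: le_measure; rewrite ?inE//.
      exact: ball_measurable_borel.
    by move=> x Px; exact: diamP Py Px.
  have -> : mu (K n) = \sum_(j <oo) mu (Pc n m j).
    rewrite -UP measure_bigcup//.
    by apply: eq_eseriesl => j; rewrite in_setT.
  rewrite -nneseriesZl//.
  apply: (@le_trans _ _ (\sum_(j <oo)
      pi_sigma [set w : Omega X | ~ (image_count w (Pc n m j) <= 1)])).
    by apply: measure_sigma_subadditive => // j; exact: m2.
  apply: lee_nneseries => // j _.
  apply: le_trans (image_count_multiple (mPc n m j) (fPc m j)) _.
  exact: lee_wpmul2r.
have mI : measurable (\bigcap_m E m) by exact: bigcapT_measurable.
apply: (@negligibleS _ _ _ pi_sigma (\bigcap_m E m)).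
  by move=> w h m _; have [j hj] := h m; exists j.
apply/negligibleP => //; apply/eqP; rewrite -measure_le0.
apply/lee_addgt0Pr => d d0; rewrite add0e.
pose M := fine (mu (K n)); have M0 : (0 <= M)%R by rewrite fine_ge0.
have M1 : (0 < M + 1)%R by rewrite ltr_wpDl.
(* M + 1 instead of M, which may vanish. *)
have [m PEm] := PE (d / (M + 1))%R (divr_gt0 d0 M1).
apply: (@le_trans _ _ (pi_sigma (E m))).
  by apply: le_measure; rewrite ?inE//; exact: bigcap_inf.
apply: le_trans PEm _; rewrite -(fineK fK) -EFinM lee_fin -/M.
by rewrite mulrAC ler_pdivrMr// ler_wpM2l ?ler_wpDr// ltW.
Qed.

Lemma tau_star_proper w : proper_image w ->
  is_image_config (tau w) w (tau_star tau w).
Proof. by move=> /proper_image_config; exact: xgetPex. Qed.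

Lemma tau_star_improper w : ~ proper_image w -> tau_star tau w = config0 Y.
Proof. by move=> nw; apply: xgetPN => eta /image_config_proper. Qed.

(** The default value of [tau_star] is the empty configuration, which avoids
    everything. *)
Lemma tau_star_void (L : set Y) : compact L ->
  tau_star tau @^-1` void_event L =
  ([set w : Omega X | image_count w L = 0] `&` [set w | proper_image w]) `|`
  ~` [set w | proper_image w].
Proof.
move=> cL; have mL := compact_measurable_borel cL.
apply/seteqP; split=> w.
  have [pw|npw] := pselect (proper_image w); last by right.
  by move=> wL; left; split => //; move: wL;
    rewrite /= /void_event/= tau_star_proper.
move=> [[wL pw]|npw]; rewrite /= /void_event/=.
  by rewrite tau_star_proper.
by rewrite tau_star_improper// /config_measure esum_set0.
Qed.

Let measurable_zero (L : set Y) : compact L ->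
  measurable [set w : Omega X | image_count w L = 0].
Proof.
move=> cL; rewrite -[X in measurable X]setTI.
exact: (measurable_image_count (compact_measurable_borel cL) measurableT
  (emeasurable_set1 0)).
Qed.

Lemma measurable_tau_star :
  measurable_fun setT (tau_star tau : Omega X -> Omega Y).
Proof.
apply: (measurability _ (measurable_void_events Y)) => _ [_ [L cL <-] <-].
have mp := measurable_proper_image; have mz := measurable_zero cL.
rewrite setTI tau_star_void//; apply: measurableU; last exact: measurableC.
exact: measurableI.
Qed.

Lemma tau_star_void_probability (L : set Y) : compact L ->
  pi_sigma (tau_star tau @^-1` void_event L) = pi_mu (void_event L).
Proof.
move=> cL; have mL := compact_measurable_borel cL.
have mp := measurable_proper_image; have mz := measurable_zero cL.
have np0 : pi_sigma (~` [set w : Omega X | proper_image w]) = 0.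
  by apply: measure_negligible; [exact: measurableC|exact: improper_image_null].
rewrite (poisson_void_event poi_mu cL) -image_count_void//; last first.
  by rewrite ltey_eq (poisson_intensity_fin_num poi_mu cL).
rewrite tau_star_void//; apply/eqP; rewrite eq_le; apply/andP; split.
  rewrite (le_trans (measureU2 _ _ _))//;
    [exact: measurableI|exact: measurableC|].
  rewrite [X in _ + X]np0 adde0; apply: le_measure; rewrite ?inE//.
  exact: measurableI.
apply: (@le_trans _ _ (pi_sigma ([set w : Omega X | image_count w L = 0] `|`
    ~` [set w | proper_image w]))).
  by apply: le_measure; rewrite ?inE//; apply: measurableU => //;
    exact: measurableC.
apply: le_measure; rewrite ?inE.
- by apply: measurableU => //; exact: measurableC.
- by apply: measurableU; [exact: measurableI|exact: measurableC].
- move=> w [wL|]; last by right.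
  by have [pw|npw] := pselect (proper_image w); [left|right].
Qed.

Lemma tau_star_maps :
  maps_measure (tau_star tau : Omega X -> Omega Y) pi_sigma pi_mu.
Proof.
split=> [|B mB]; first exact: measurable_tau_star.
have void0_in : void_events (@void_event R Y set0).
  by exists set0 => //; exact: compact0.
have [m mE] := pushforward_measure_ex pi_sigma measurable_tau_star.
rewrite /pushforward -mE; apply: (@measure_unique _ R (Omega Y)
  (@void_events R Y)
  (fun=> void_event set0) _ _ _ _ m pi_mu _ _ B mB).
- exact: measurable_void_events.
- exact: void_events_setI.
- by [].
- by rewrite void_event0 bigcup_const.
- by move=> _ [L cL <-]; rewrite mE; exact: tau_star_void_probability.
- move=> _; rewrite mE void_event0 preimage_setT.
  by rewrite [X in X < _](probability_setT pi_sigma) ltry.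
Qed.

End partitions.

End transport.

Theorem theorem3p3 (R : realType) (X Y : pmetricType R)
    (sigma : {sigma_finite_measure set (borel X) -> \bar R})
    (mu : {sigma_finite_measure set (borel Y) -> \bar R})
    (pi_sigma : probability (Omega X) R) (pi_mu : probability (Omega Y) R)
    (tau : config X -> X -> Y) :
  sigma_compact X -> sigma_compact Y ->
  diffuse sigma -> diffuse mu ->
  is_poisson_measure sigma pi_sigma ->
  is_poisson_measure mu pi_mu ->
  measurable_fun setT
    (fun p : (Omega X * borel X)%type => tau p.1 p.2 : borel Y) ->
  (forall w : config X,
    maps_measure (tau w : borel X -> borel Y) sigma mu) ->
  cyclic_condition tau ->
  {ae pi_sigma, forall w : Omega X, is_image_config (tau w) w (tau_star tau w)}
  /\ maps_measure (tau_star tau : Omega X -> Omega Y) pi_sigma pi_mu.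
Proof.
move=> sX sY difs difm poi_sigma poi_mu mtau tau_maps cyc.
have [K [cK _ UK]] := sigma_compact_nondecreasing sY.
have /choice[Pc PcP] : forall nm : nat * nat, exists P : nat -> set Y,
    [/\ forall j, measurable (P j : set (borel Y)),
      trivIset setT P, \bigcup_j P j = K nm.1 &
      forall j x y, P j x -> P j y -> ball x (nm.2.+1%:R^-1 : R) y].
  move=> [n m]; have [P [dP tP UP bP]] := compact_partition (cK n)
    (inv_succ_gt0 m).
  exists P; split => // j; have [C [C' [cC cC' ->]]] := dP j.
  by apply: measurableD; exact: compact_measurable_borel.
pose Pc' n m := Pc (n, m).
have PcP' n m := PcP (n, m).
split; last exact: (tau_star_maps sX sY difs difm poi_sigma poi_mu mtau
  tau_maps cyc
  cK UK (Pc := Pc') PcP').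
apply: negligibleS (improper_image_null sX sY difs difm poi_sigma poi_mu mtau
  tau_maps cyc cK (Pc := Pc') PcP').
move=> w /= nw; apply: contra_not nw => pw.
exact: (tau_star_proper UK PcP').
Qed.
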